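(* For every fixed TDAG $G'$ there is an algorithm that, given a TDAG $G$, decides in time polynomial in the size of $G$ whether $G'$ is d-embedded in $G$, and likewise whether $G'$ is a d-minor of $G$.
   Context: A 2-terminal directed graph $G=\langle V,E,s,t\rangle$ is a directed multigraph without self-loops with distinguished vertices $s,t$ such that every vertex and edge lies on at least one simple directed $s$–$t$ path; a TDAG is such a graph with no directed cycle. d-minors: $G'$ is a d-minor of $G$ if a graph isomorphic to $G'$ is obtained from $G$ by a finite (possibly empty) sequence of: (Deletion) delete an edge $(a,b)$ where $a$ has outdegree $\geq 2$ and $b$ has indegree $\geq 2$; (Backward contraction) contract an edge $(a,b)$ where $b$ has indegree 1; (Forward contraction) contract an edge $(a,b)$ where $a$ has outdegree 1 (contraction merges $a,b$ into one vertex incident to all their other edges). d-embeddings: $G'$ is d-embedded in $G$ if $G$ is isomorphic to a graph obtained from $G'$ by a finite (possibly empty) sequence of: (Addition) add a new edge $(a,b)$ between existing vertices with no directed path from $b$ to $a$; (Forward split) replace a vertex $a\neq t$ by vertices $a,b$ and a new edge $(a,b)$, $a$ retaining all incoming edges and the outgoing edges being distributed between $a$ and $b$ with $b$ retaining at least one; (Backward split) replace a vertex $b\neq s$ by vertices $a,b$ and a new edge $(a,b)$, $b$ retaining all outgoing edges and the incoming edges being distributed with $a$ retaining at least one. *)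

(* Defs.v *)
From Stdlib Require Import Relation_Operators.
From mathcomp Require Import all_boot.

Set Implicit Arguments.
Unset Strict Implicit.
Unset Printing Implicit Defensive.

(** * Directed multigraphs with two terminals *)

Record mgraph : Type := MGraph {
  vert : finType;
  edge : finType;
  esrc : edge -> vert;
  etgt : edge -> vert;
  source : vert;
  sink : vert
}.

Arguments esrc {m}.
Arguments etgt {m}.

Section Graph.
Variable G : mgraph.
Implicit Types (x y v : vert G) (e : edge G) (p : seq (edge G)).

Definition outdeg x := #|[set e : edge G | esrc e == x]|.
Definition indeg x := #|[set e : edge G | etgt e == x]|.

(* Parallel edges are distinct, so walks are sequences of edges. *)
Fixpoint walk x p y : bool :=
  if p is e :: p' then (esrc e == x) && walk (etgt e) p' y else x == y.

Definition simple_path x p y : bool :=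
  walk x p y && uniq (x :: map etgt p).

Definition dcycle x p : bool :=
  [&& p != [::], walk x p x & uniq (map etgt p)].

Definition reaches x y : Prop := exists p, simple_path x p y.

End Graph.

(* [source G <> sink G] is not required: the only graph it would exclude is the
   one with a single vertex and no edge. *)
Definition two_terminal (G : mgraph) : Prop :=
  [/\ forall e : edge G, esrc e != etgt e,
      forall v : vert G, exists2 p : seq (edge G),
        simple_path (source G) p (sink G) & v \in source G :: map etgt p
    & forall e : edge G, exists2 p : seq (edge G),
        simple_path (source G) p (sink G) & e \in p].

Definition tdag (G : mgraph) : Prop :=
  two_terminal G /\ forall (x : vert G) (p : seq (edge G)), ~~ dcycle x p.

Definition graph_iso (G H : mgraph) : Prop :=
  exists (f : vert G -> vert H) (g : edge G -> edge H),
    [/\ bijective f /\ bijective g,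
        forall e, esrc (g e) = f (esrc e),
        forall e, etgt (g e) = f (etgt e),
        f (source G) = source H
      & f (sink G) = sink H].

(** * d-minors *)

Definition delete_edge (G : mgraph) (e : edge G) : mgraph :=
  @MGraph (vert G) {f : edge G | f != e}
    (fun f => esrc (val f)) (fun f => etgt (val f)) (source G) (sink G).

Section Contract.
Variables (G : mgraph) (e : edge G) (he : esrc e != etgt e).

(* The vertex obtained by merging the ends of [e] is represented by [esrc e]:
   [merge_ends] sends [etgt e] to [esrc e] and fixes every other vertex. *)
Definition merge_ends (x : vert G) : {x : vert G | x != etgt e} :=
  insubd (exist (fun x => x != etgt e) (esrc e) he) x.

Definition contract_edge : mgraph :=
  @MGraph {x : vert G | x != etgt e} {f : edge G | f != e}
    (fun f => merge_ends (esrc (val f))) (fun f => merge_ends (etgt (val f)))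
    (merge_ends (source G)) (merge_ends (sink G)).

End Contract.

Inductive minor_step (G : mgraph) : mgraph -> Prop :=
| Deletion (e : edge G) :
    1 < outdeg (esrc e) -> 1 < indeg (etgt e) ->
    minor_step G (delete_edge e)
| BackwardContraction (e : edge G) (he : esrc e != etgt e) :
    indeg (etgt e) = 1 -> minor_step G (contract_edge he)
| ForwardContraction (e : edge G) (he : esrc e != etgt e) :
    outdeg (esrc e) = 1 -> minor_step G (contract_edge he).

Definition d_minor (G' G : mgraph) : Prop :=
  exists2 H, clos_refl_trans mgraph minor_step G H & graph_iso H G'.

(** * d-embeddings *)

(* In the next three constructions [None] is the new edge and, in the splits,
   also the new vertex. *)
Definition add_edge (G : mgraph) (a b : vert G) : mgraph :=
  @MGraph (vert G) (option (edge G))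
    (oapp esrc a) (oapp etgt b) (source G) (sink G).

(* [a] is replaced by [Some a -> None]; the edges in [D] now leave [None]. *)
Definition forward_split (G : mgraph) (a : vert G) (D : {set edge G}) : mgraph :=
  @MGraph (option (vert G)) (option (edge G))
    (fun f => if f is Some e then if e \in D then None else Some (esrc e)
              else Some a)
    (fun f => if f is Some e then Some (etgt e) else None)
    (Some (source G)) (Some (sink G)).

(* [b] is replaced by [None -> Some b]; the edges in [D] now enter [None]. *)
Definition backward_split (G : mgraph) (b : vert G) (D : {set edge G}) : mgraph :=
  @MGraph (option (vert G)) (option (edge G))
    (fun f => if f is Some e then Some (esrc e) else None)
    (fun f => if f is Some e then if e \in D then None else Some (etgt e)
              else Some b)
    (Some (source G)) (Some (sink G)).

Inductive embed_step (G : mgraph) : mgraph -> Prop :=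
| Addition (a b : vert G) :
    ~ reaches b a -> embed_step G (add_edge a b)
| ForwardSplit (a : vert G) (D : {set edge G}) :
    a != sink G -> D != set0 -> D \subset [set e | esrc e == a] ->
    embed_step G (forward_split a D)
| BackwardSplit (b : vert G) (D : {set edge G}) :
    b != source G -> D != set0 -> D \subset [set e | etgt e == b] ->
    embed_step G (backward_split b D).

Definition d_embedded (G' G : mgraph) : Prop :=
  exists2 H, clos_refl_trans mgraph embed_step G' H & graph_iso G H.

(** * Polynomial-time decidability *)

(* Algorithms are structured programs for a random access machine with
   registers and a memory of natural numbers.  Every instruction and every test
   has unit cost.  The only arithmetic is addition and truncated subtraction
   (no multiplication), so the bit length of the values grows by at most one per
   instruction and running times agree with Turing machine running times up to
   a polynomial. *)
Inductive com : Type :=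
| Skip
| SetConst (r n : nat)
| SetAdd (r a b : nat)
| SetSub (r a b : nat)
| Fetch (r a : nat)
| Store (a r : nat)
| Seq (c1 c2 : com)
| If (r : nat) (c1 c2 : com)
| While (r : nat) (c : com).

Record state : Type := State { reg : nat -> nat; mem : nat -> nat }.

Definition set_reg (st : state) (r v : nat) : state :=
  State (fun i => if i == r then v else reg st i) (mem st).

Definition set_mem (st : state) (a v : nat) : state :=
  State (reg st) (fun i => if i == a then v else mem st i).

(* [exec c st k st']: started in [st], [c] halts in [st'] after [k] steps. *)
Inductive exec : com -> state -> nat -> state -> Prop :=
| exec_skip st : exec Skip st 1 st
| exec_const st r n : exec (SetConst r n) st 1 (set_reg st r n)
| exec_add st r a b :
    exec (SetAdd r a b) st 1 (set_reg st r (reg st a + reg st b))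
| exec_sub st r a b :
    exec (SetSub r a b) st 1 (set_reg st r (reg st a - reg st b))
| exec_fetch st r a :
    exec (Fetch r a) st 1 (set_reg st r (mem st (reg st a)))
| exec_store st a r :
    exec (Store a r) st 1 (set_mem st (reg st a) (reg st r))
| exec_seq st st1 st2 c1 c2 k1 k2 :
    exec c1 st k1 st1 -> exec c2 st1 k2 st2 ->
    exec (Seq c1 c2) st (k1 + k2) st2
| exec_if st st1 r c1 c2 k :
    exec (if reg st r != 0 then c1 else c2) st k st1 ->
    exec (If r c1 c2) st k.+1 st1
| exec_while_stop st r c :
    reg st r = 0 -> exec (While r c) st 1 st
| exec_while_loop st st1 st2 r c k1 k2 :
    reg st r != 0 -> exec c st k1 st1 -> exec (While r c) st1 k2 st2 ->
    exec (While r c) st (k1 + k2).+1 st2.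

(* The input word is in memory from address 0 on and its length in register 0;
   everything else is 0. *)
Definition init_state (w : seq nat) : state :=
  State (fun i => if i == 0 then size w else 0) (nth 0 w).

(* Vertices are numbered by [enum_rank]; since [G] ranges over graphs on
   arbitrary finite types, every numbering of the vertices and every ordering of
   the edge list of a graph occurs, up to isomorphism, among the inputs. *)
Definition encode (G : mgraph) : seq nat :=
  [:: #|vert G|, #|edge G|,
      val (enum_rank (source G)), val (enum_rank (sink G)) &
      flatten [seq [:: val (enum_rank (esrc e)); val (enum_rank (etgt e))]
              | e <- enum (edge G)]].

Definition gsize (G : mgraph) : nat := #|vert G| + #|edge G|.

(* Promise version: the behaviour on inputs outside [D] is unconstrained. *)
Definition ptime_decidable (D Q : mgraph -> Prop) : Prop :=
  exists (c : com) (a k : nat), forall G, D G ->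
    exists (n : nat) (st : state),
      [/\ exec c (init_state (encode G)) n st,
          n <= a * gsize G ^ k + a
        & (reg st 0 != 0) <-> Q G].

(* Main.v *)
(* A model of [G'] in [G] partitions some vertices of [G] into branch sets, one
   for each vertex of [G'], each of them an in-tree and an out-tree sharing their
   root; the edges of [G'] are represented by edges of [G] that leave an out-tree
   and enter an in-tree.  If [G'] has more than one vertex, a minor step can be
   undone by an embedding step, a model can be carried along an embedding step,
   and a graph with a model can be reduced to [G'] by deleting or contracting
   edges; hence d-minors, d-embeddings and models are the same thing.

   Following Fortune, Hopcroft and Wyllie, models are found with pebbles.  For
   each edge [f] of [G'] a pebble walks in [G] from the root of the tail of [f]
   to the root of its head.  The vertices of [G] are processed by increasing
   level, where levels strictly increase along edges, so that pebbles sharing a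
   vertex pass through it simultaneously and their compatibility can be checked
   at that moment.  A configuration consists of boundedly many numbers smaller
   than the size of the input, so a table of the reachable configurations is
   computed in polynomial time. *)

Require Import Defs.
From Stdlib Require Import Relation_Operators Operators_Properties.
From mathcomp Require Import all_boot zify.

Set Implicit Arguments.
Unset Strict Implicit.
Unset Printing Implicit Defensive.

(** * Bounded loop programs *)

(** The obstacle is that branch sets are disjoint trees, a global condition, while a configuration
    keeps only one edge per pebble. Levels remove it: all pebbles that ever pass a vertex are about
    to enter it when its level is processed, so every violation of disjointness or of the tree shape
    shows within a single step, and no set of visited vertices has to be stored. The number of
    entries of a configuration depends on the pattern alone, hence there are polynomially many
    configurations.

    In a model, every vertex of a branch set other than a terminal has a used edge on either side.

    The one-vertex pattern is exceptional because no embedding step applies to it, whereas every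
    graph contracts to it.

    The algorithm is written in a small language whose only loop runs [L] times, for [L] the input
    length plus a constant; a polynomial time bound is then a property of the language and not of
    the algorithm. *)

Inductive expr : Type :=
| Var (i : nat)
| Cst (n : nat)
| Len
| Plus (a b : expr)
| Minus (a b : expr)
| MulLen (a : expr)
| Peek (a : expr)
| Ite (a b c : expr).

Inductive prog : Type :=
| Write (a b : expr)
| Then (p q : prog)
| When (a : expr) (p : prog)
| For (p : prog).

Section Semantics.
Variable L : nat.
Implicit Types (env : seq nat) (m : nat -> nat).

Fixpoint eval env m a : nat :=
  match a with
  | Var i => nth 0 env i
  | Cst n => n
  | Len => L
  | Plus a b => eval env m a + eval env m b
  | Minus a b => eval env m a - eval env m b
  | MulLen a => eval env m a * L
  | Peek a => m (eval env m a)
  | Ite a b c => if eval env m a != 0 then eval env m b else eval env m c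
  end.

Fixpoint den p env m : nat -> nat :=
  match p with
  | Write a b =>
      fun i => if i == eval env m a then eval env m b else m i
  | Then p q => den q env (den p env m)
  | When a p => if eval env m a != 0 then den p env m else m
  | For p => foldl (fun m i => den p (rcons env i) m) m (iota 0 L)
  end.

End Semantics.

(* Register 1 holds [L], register [i + 2] the [i]-th enclosing loop variable,
   and the registers from [d + 2] on, where [d] is the loop depth, are free. *)
Fixpoint compile_expr (d r : nat) (a : expr) : com :=
  match a with
  | Var i =>
      if i < d then Seq (SetConst r 0) (SetAdd r i.+2 r) else SetConst r 0
  | Cst n => SetConst r n
  | Len => Seq (SetConst r 0) (SetAdd r 1 r)
  | Plus a b =>
      Seq (compile_expr d r a) (Seq (compile_expr d r.+1 b) (SetAdd r r r.+1))
  | Minus a b =>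
      Seq (compile_expr d r a) (Seq (compile_expr d r.+1 b) (SetSub r r r.+1))
  | MulLen a =>
      Seq (compile_expr d r.+1 a) (Seq (SetConst r 0) (Seq (SetConst r.+2 1)
        (Seq (SetConst r.+3 0) (Seq (SetAdd r.+3 1 r.+3)
          (While r.+3 (Seq (SetAdd r r r.+1) (SetSub r.+3 r.+3 r.+2)))))))
  | Peek a => Seq (compile_expr d r a) (Fetch r r)
  | Ite a b c =>
      Seq (compile_expr d r a)
        (If r (compile_expr d r b) (compile_expr d r c))
  end.

(** For a loop, [d.+2] is the loop variable and [d.+3] the number of remaining rounds, which is
    recomputed after the body because the body may overwrite every register from [d.+3] on. *)
Fixpoint compile (d : nat) (p : prog) : com :=
  match p with
  | Write a b =>
      Seq (compile_expr d d.+2 a)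
        (Seq (compile_expr d d.+3 b) (Store d.+2 d.+3))
  | Then p q => Seq (compile d p) (compile d q)
  | When a p => Seq (compile_expr d d.+2 a) (If d.+2 (compile d p) Skip)
  | For p =>
      Seq (SetConst d.+2 0) (Seq (SetSub d.+3 1 d.+2)
        (While d.+3 (Seq (compile d.+1 p) (Seq (SetConst d.+3 1)
          (Seq (SetAdd d.+2 d.+2 d.+3) (SetSub d.+3 1 d.+2))))))
  end.

(** * Correctness and cost of compiled programs *)

Section Correctness.
Implicit Types (L d r n k : nat) (env : seq nat) (m : nat -> nat) (st : state).

Definition represents L env m st : Prop :=
  [/\ reg st 1 = L, forall i, i < size env -> reg st i.+2 = nth 0 env i
    & Defs.mem st = m].

Lemma represents_regs L env m st st' :
  represents L env m st -> (forall i, i < (size env).+2 -> reg st' i = reg st i) ->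
  Defs.mem st' = Defs.mem st -> represents L env m st'.
Proof.
move=> [h1 h2 h3] hr hm; split=> [|i hi|]; rewrite ?hr ?hm //; exact: h2.
Qed.

Ltac reg_cases :=
  rewrite /=; repeat (case: eqP => ?; try (exfalso; lia)).

(** Multiplication by repeated addition: [r] accumulates multiples of [r.+1], and [r.+3] counts down
    by the constant 1 kept in [r.+2]. *)
Lemma exec_mul_loop r L st :
  reg st r.+3 = L -> reg st r.+2 = 1 ->
  exists st',
    [/\ exec (While r.+3 (Seq (SetAdd r r r.+1) (SetSub r.+3 r.+3 r.+2)))
          st (3 * L).+1 st',
        reg st' r = reg st r + reg st r.+1 * L,
        forall i, i < r -> reg st' i = reg st i
      & Defs.mem st' = Defs.mem st].
Proof.
elim: L st => [|L IH] st h3 h2.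
  exists st; split=> //; last by rewrite muln0 addn0.
  exact: exec_while_stop.
set st1 := set_reg st r (reg st r + reg st r.+1).
set st2 := set_reg st1 r.+3 (reg st1 r.+3 - reg st1 r.+2).
have [||st' [hex hr hlt hm]] := IH st2.
- by rewrite /st2 /st1; reg_cases; lia.
- by rewrite /st2 /st1; reg_cases.
exists st'; split.
- have -> : (3 * L.+1).+1 = ((1 + 1) + (3 * L).+1).+1 by lia.
  apply: exec_while_loop hex; first by rewrite h3.
  by apply: exec_seq; [exact: exec_add|exact: exec_sub].
- by rewrite hr /st2 /st1; reg_cases; lia.
- by move=> i hi; rewrite hlt // /st2 /st1; reg_cases.
- by rewrite hm.
Qed.

(** The cost is linear in [L] because of the loop of [MulLen]. Registers below [r] survive, so the
    left operand can wait in [r] while the right one is computed from [r.+1] on. *)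
Lemma compile_expr_correct (a : expr) d :
  exists c, forall r L env m st,
    size env = d -> d.+2 <= r -> represents L env m st ->
    exists n st',
      [/\ exec (compile_expr d r a) st n st', n <= c * L.+1,
          reg st' r = eval L env m a,
          forall i, i < r -> reg st' i = reg st i
        & Defs.mem st' = Defs.mem st].
Proof.
elim: a => [i|n||a [ca IHa] b [cb IHb]|a [ca IHa] b [cb IHb]|a [ca IHa]|a [ca IHa]
  |a [ca IHa] b [cb IHb] c [cc IHc]] /=.
- exists 2 => r L env m st hd hr [h1 h2 hm].
  case: ltnP => hi.
    do 2!eexists; split.
    + by apply: exec_seq; [exact: exec_const|exact: exec_add].
    + lia.
    + by rewrite -h2 ?hd //=; reg_cases; rewrite ?addn0.
    + by move=> j hj; reg_cases.
    + by [].
  do 2!eexists; split; first exact: exec_const; rewrite //=.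
  + by rewrite eqxx nth_default ?hd.
  + by move=> j hj; reg_cases.
- exists 1 => r L env m st hd hr _.
  do 2!eexists; split; first exact: exec_const; rewrite //= ?eqxx //.
  by move=> j hj; reg_cases.
- exists 2 => r L env m st hd hr [h1 h2 hm].
  do 2!eexists; split.
  + by apply: exec_seq; [exact: exec_const|exact: exec_add].
  + lia.
  + by reg_cases; lia.
  + by move=> j hj; reg_cases.
  + by [].
- exists (ca + cb).+1 => r L env m st hd hr hst.
  have [na [sa [hea hna hva hra hma]]] := IHa _ _ _ _ _ hd hr hst.
  have hsa : represents L env m sa.
    by apply: represents_regs hst _ hma => i hi; apply: hra; lia.
  have [nb [sb [heb hnb hvb hrb hmb]]] := IHb _ _ _ _ _ hd (leqW hr) hsa.
  do 2!eexists; split.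
  + apply: exec_seq hea _; apply: exec_seq heb _; exact: exec_add.
  + lia.
  + by rewrite /= eqxx hvb hrb // hva.
  + by move=> j hj; reg_cases; rewrite hrb ?hra //; lia.
  + by rewrite /= hmb.
- exists (ca + cb).+1 => r L env m st hd hr hst.
  have [na [sa [hea hna hva hra hma]]] := IHa _ _ _ _ _ hd hr hst.
  have hsa : represents L env m sa.
    by apply: represents_regs hst _ hma => i hi; apply: hra; lia.
  have [nb [sb [heb hnb hvb hrb hmb]]] := IHb _ _ _ _ _ hd (leqW hr) hsa.
  do 2!eexists; split.
  + apply: exec_seq hea _; apply: exec_seq heb _; exact: exec_sub.
  + lia.
  + by rewrite /= eqxx hvb hrb // hva.
  + by move=> j hj; reg_cases; rewrite hrb ?hra //; lia.
  + by rewrite /= hmb.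
- exists (ca + 8) => r L env m st hd hr hst.
  have [na [sa [hea hna hva hra hma]]] := IHa _ _ _ _ _ hd (leqW hr) hst.
  set s1 := set_reg sa r 0.
  set s2 := set_reg s1 r.+2 1.
  set s3 := set_reg s2 r.+3 0.
  set s4 := set_reg s3 r.+3 (reg s3 1 + reg s3 r.+3).
  have [h1 h2 hm] := hst.
  have e1 : reg s3 1 = L by rewrite -h1 -hra; [rewrite /s3; reg_cases|lia].
  have [||s5 [he5 hr5 hlt5 hm5]] := @exec_mul_loop r L s4.
  + have -> : reg s4 r.+3 = reg s3 1 + reg s3 r.+3 by rewrite /s4 /= eqxx.
    by rewrite e1 /s3 /= eqxx addn0.
  + by rewrite /s4; reg_cases.
  do 2!eexists; split.
  + apply: exec_seq hea _; apply: exec_seq (exec_const _ _ _) _.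
    apply: exec_seq (exec_const _ _ _) _; apply: exec_seq (exec_const _ _ _) _.
    by apply: exec_seq (exec_add _ _ _ _) _; exact: he5.
  + lia.
  + by rewrite hr5 -hva /s4; reg_cases.
  + by move=> j hj; rewrite hlt5 // -hra; [rewrite /s4; reg_cases|lia].
  + by rewrite hm5 /s4 /= hma.
- exists ca.+1 => r L env m st hd hr hst.
  have [na [sa [hea hna hva hra hma]]] := IHa _ _ _ _ _ hd hr hst.
  have [_ _ hm] := hst.
  do 2!eexists; split.
  + apply: exec_seq hea _; exact: exec_fetch.
  + lia.
  + by rewrite /= eqxx hva hma hm.
  + by move=> j hj; reg_cases; exact: hra.
  + by rewrite /= hma.
- exists (ca + cb + cc).+1 => r L env m st hd hr hst.
  have [na [sa [hea hna hva hra hma]]] := IHa _ _ _ _ _ hd hr hst.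
  have hsa : represents L env m sa.
    by apply: represents_regs hst _ hma => i hi; apply: hra; lia.
  case: ifP => hif.
    have [nb [sb [heb hnb hvb hrb hmb]]] := IHb _ _ _ _ _ hd hr hsa.
    exists (na + nb.+1), sb; split=> //; last by rewrite hmb.
    + by apply: exec_seq hea _; apply: exec_if; rewrite hva hif.
    + lia.
    + by move=> j hj; rewrite hrb ?hra.
  have [nb [sb [heb hnb hvb hrb hmb]]] := IHc _ _ _ _ _ hd hr hsa.
  exists (na + nb.+1), sb; split=> //; last by rewrite hmb.
  + by apply: exec_seq hea _; apply: exec_if; rewrite hva hif.
  + lia.
  + by move=> j hj; rewrite hrb ?hra.
Qed.

(** Keeps time bounds in the form [c * L.+1 ^ k] under sequencing; the base is positive, so
    exponents may be raised. *)
Lemma leq_pow_monomials a b k l x :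
  a * x.+1 ^ k + b * x.+1 ^ l <= (a + b) * x.+1 ^ (k + l).
Proof.
rewrite mulnDl leq_add // leq_mul2l leq_pexp2l ?orbT //; lia.
Qed.

Lemma compile_correct (p : prog) d :
  exists c k, forall L env m st,
    size env = d -> represents L env m st ->
    exists n st',
      [/\ exec (compile d p) st n st', n <= c * L.+1 ^ k
        & represents L env (den L p env m) st'].
Proof.
elim: p d => [a b|p IHp q IHq|a p IHp|p IHp] d /=.
- have [ca Ha] := compile_expr_correct a d.
  have [cb Hb] := compile_expr_correct b d.
  exists (ca + cb).+1, 1 => L env m st hd hst.
  have [na [sa [hea hna hva hra hma]]] := Ha _ _ _ _ _ hd (leqnn _) hst.
  have hsa : represents L env m sa.
    by apply: represents_regs hst _ hma => i hi; apply: hra; rewrite -hd.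
  have [nb [sb [heb hnb hvb hrb hmb]]] := Hb _ _ _ _ _ hd (leqW (leqnn _)) hsa.
  have [h1 h2 hm] := hsa.
  do 2!eexists; split.
  + apply: exec_seq hea _; apply: exec_seq heb _; exact: exec_store.
  + rewrite expn1; lia.
  + split=> [|i hi|] /=; rewrite ?hvb ?hrb ?h1 ?hva ?hmb ?hm //; last by lia.
    exact: h2.
- have [ca [ka Ha]] := IHp d; have [cb [kb Hb]] := IHq d.
  exists (ca + cb), (ka + kb) => L env m st hd hst.
  have [na [sa [hea hna hsa]]] := Ha _ _ _ _ hd hst.
  have [nb [sb [heb hnb hsb]]] := Hb _ _ _ _ hd hsa.
  exists (na + nb), sb; split=> //; first exact: exec_seq hea heb.
  exact: leq_trans (leq_add hna hnb) (leq_pow_monomials _ _ _ _ _).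
- have [ca Ha] := compile_expr_correct a d.
  have [cb [kb Hb]] := IHp d.
  exists (ca + 2 + cb), (1 + kb) => L env m st hd hst.
  have [na [sa [hea hna hva hra hma]]] := Ha _ _ _ _ _ hd (leqnn _) hst.
  have hsa : represents L env m sa.
    by apply: represents_regs hst _ hma => i hi; apply: hra; rewrite -hd.
  have := leq_pow_monomials (ca + 2) cb 1 kb L; rewrite expn1 => hpow.
  case: ifP => hif.
    have [nb [sb [heb hnb hsb]]] := Hb _ _ _ _ hd hsa.
    exists (na + nb.+1), sb; split=> //; last by apply: leq_trans hpow; lia.
    by apply: exec_seq hea _; apply: exec_if; rewrite hva hif.
  exists (na + 2), sa; split=> //; last by apply: leq_trans hpow; lia.
  by apply: exec_seq hea _; apply: exec_if; rewrite hva hif; exact: exec_skip.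
- have [c [k H]] := IHp d.+1.
  exists (c + 7), k.+1 => L env m st hd hst.
  set body := Seq (compile d.+1 p) _.
  set f := fun m i => den L p (rcons env i) m.
  (* Induction on the number [j] of remaining rounds; the loop variable is then [L - j]. Each round
     costs the body, three instructions and one test, whence the 4. *)
  have loop j : j <= L -> forall m' s,
      represents L env m' s -> reg s d.+2 = L - j -> reg s d.+3 = j ->
      exists n s', [/\ exec (While d.+3 body) s n s',
        n <= (c * L.+1 ^ k + 4) * j + 1
        & represents L env (foldl f m' (iota (L - j) j)) s'].
    elim: j => [|j IHj] hj m' s hs h2 h3.
      exists 1, s; split=> //; [exact: exec_while_stop|lia].
    have hs' : represents L (rcons env (L - j.+1)) m' s.
      case: hs => e1 e2 e3; split=> // i.
        rewrite size_rcons nth_rcons ltnS leq_eqVlt => /orP[/eqP->|hi].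
          by rewrite ltnn eqxx hd.
        by rewrite hi e2.
    have [|n1 [s1 [ex1 hn1 hr1]]] := H _ _ _ _ _ hs'; first by rewrite size_rcons hd.
    have [e1 e2 e3] := hr1.
    have e2d : reg s1 d.+2 = L - j.+1.
      by rewrite e2 ?size_rcons ?hd // nth_rcons hd ltnn eqxx.
    set s2 := set_reg s1 d.+3 1.
    set s3 := set_reg s2 d.+2 (reg s2 d.+2 + reg s2 d.+3).
    set s4 := set_reg s3 d.+3 (reg s3 1 - reg s3 d.+2).
    have v3 : reg s3 d.+2 = L - j.
      by move: e2d; rewrite /s3 /s2; reg_cases; lia.
    have v1 : reg s3 1 = L by move: e1; rewrite /s3 /s2; reg_cases.
    have [||||n2 [s5 [ex5 hn5 hr5]]] := IHj _ (f m' (L - j.+1)) s4.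
    + lia.
    + split.
      * by move: e1; rewrite /s4 /s3 /s2; reg_cases.
      * move=> i hi; transitivity (reg s1 i.+2).
          by rewrite /s4 /s3 /s2; reg_cases.
        by rewrite e2 ?nth_rcons ?hi // size_rcons ltnW.
      * by rewrite /= e3.
    + by rewrite -v3 /s4; reg_cases.
    + have -> : reg s4 d.+3 = reg s3 1 - reg s3 d.+2 by rewrite /s4 /= eqxx.
      by rewrite v1 v3; lia.
    exists (n1 + (1 + (1 + 1)) + n2).+1, s5; split.
    + apply: exec_while_loop ex5; first by rewrite h3.
      apply: exec_seq ex1 _; apply: exec_seq (exec_const _ _ _) _.
      by apply: exec_seq (exec_add _ _ _ _) _; exact: exec_sub.
    + by move: hn1 hn5; set X := c * _; nia.
    + have -> : iota (L - j.+1) j.+1 = L - j.+1 :: iota (L - j) j.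
        by rewrite /=; congr (_ :: iota _ _); lia.
      exact: hr5.
  set s1 := set_reg st d.+2 0.
  set s2 := set_reg s1 d.+3 (reg s1 1 - reg s1 d.+2).
  have [h1 h2 hm] := hst.
  have [|||n [s3 [ex3 hn hr]]] := loop L (leqnn L) m s2.
  + split=> //; move=> i hi.
    by rewrite -h2 // /s2 /s1; reg_cases.
  + by rewrite subnn /s2 /s1; reg_cases.
  + by rewrite -h1 /s2 /s1; reg_cases; lia.
  exists (1 + (1 + n)), s3; split.
  + apply: exec_seq (exec_const _ _ _) _.
    by apply: exec_seq (exec_sub _ _ _ _) _; exact: ex3.
  + rewrite expnS; move: hn; have : 0 < L.+1 ^ k by rewrite expn_gt0.
    by move: (L.+1 ^ k) => X; nia.
  + by move: hr; rewrite subnn.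
Qed.

End Correctness.

Lemma size_encode G : size (encode G) = 4 + 2 * #|edge G|.
Proof.
rewrite /= size_flatten /shape -map_comp (@eq_map _ _ _ (fun=> 2)) //.
rewrite cardE; elim: (enum _) => //= e s; lia.
Qed.

(* A program may use any loop bound that exceeds the input length by a
   constant. *)
Lemma ptime_decidable_prog (D Q : mgraph -> Prop) (C : nat) (p : prog) (a : expr) :
  (forall G, D G ->
    let L := size (encode G) + C in
    eval L [::] (den L p [::] (nth 0 (encode G))) a != 0 <-> Q G) ->
  ptime_decidable D Q.
Proof.
move=> hQ.
have [c [k Hp]] := compile_correct p 0.
have [ca Ha] := compile_expr_correct a 0.
pose prg := Seq (SetConst 1 C) (Seq (SetAdd 1 0 1) (Seq (compile 0 p)
  (Seq (compile_expr 0 2 a) (Seq (SetConst 1 0) (SetAdd 0 2 1))))).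
(* [L.+1] equals [2 * #|edge G| + C + 5], which is at most [(C + 7) * gsize G] because [gsize G] is
   positive. *)
exists prg, ((c + (ca + 4)) * (C + 7) ^ k.+1), k.+1 => G /hQ.
set L := size _ + C => {}hQ.
set st0 := init_state _.
set s1 := set_reg st0 1 C; set s2 := set_reg s1 1 (reg s1 0 + reg s1 1).
have h2 : represents L [::] (nth 0 (encode G)) s2 by split.
have [n3 [s3 [ex3 hn3 hr3]]] := Hp L [::] _ _ erefl h2.
have [n4 [s4 [ex4 hn4 hv4 _ _]]] := Ha 2 L [::] _ _ erefl (leqnn 2) hr3.
do 2!eexists; split.
- apply: exec_seq (exec_const _ _ _) _; apply: exec_seq (exec_add _ _ _ _) _.
  apply: exec_seq ex3 _; apply: exec_seq ex4 _.
  by apply: exec_seq (exec_const _ _ _) _; exact: exec_add.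
- apply: (@leq_trans ((c + (ca + 4)) * L.+1 ^ k.+1)).
    have := leq_pow_monomials c (ca + 4) k 1 L.
    rewrite expn1 addn1; move=> h; apply: leq_trans h; lia.
  have hG : L.+1 <= (C + 7) * gsize G.
    have : 0 < #|vert G| by apply/card_gt0P; exists (source G).
    by rewrite /L size_encode /gsize; nia.
  rewrite -mulnA -expnMn; apply: leq_trans (leq_addr _ _).
  by rewrite leq_mul2l leq_exp2r ?hG ?orbT.
- by rewrite /= addn0 hv4.
Qed.

(** * Two-terminal acyclic graphs *)

(** Reversal exchanges forward and backward operations, so these are treated on one side only and
    transferred. *)
Definition rev_graph (G : mgraph) : mgraph :=
  @MGraph (vert G) (edge G) etgt esrc (sink G) (source G).

Lemma rev_graphK G : rev_graph (rev_graph G) = G.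
Proof. by case: G. Qed.

(** A local form of [tdag]: edges followed forwards or backwards from a vertex must end at the sink
    or at the source. It is easier to carry through minor steps than the paths are. *)
Definition dag (G : mgraph) : Prop :=
  [/\ exists d : vert G -> nat, forall e, d (esrc e) < d (etgt e),
      forall v : vert G, v != source G -> exists e, etgt e = v
    & forall v : vert G, v != sink G -> exists e, esrc e = v].

Lemma dag_rev G : dag G -> dag (rev_graph G).
Proof.
move=> [[d hd] hi ho]; split=> //.
pose D := \max_v d v; have hD v : d v <= D by exact: leq_bigmax.
exists (fun v => D - d v) => e /=.
by have := hd e; have := hD (@esrc G e); have := hD (@etgt G e); lia.
Qed.

(** Going back along entering edges lowers [d] and can only stop at the source. *)
Lemma source_minimal G (d : vert G -> nat) :
  (forall e, d (esrc e) < d (etgt e)) ->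
  (forall v : vert G, v != source G -> exists e, etgt e = v) ->
  forall v, d (source G) <= d v.
Proof.
move=> hd hi v; have [n] := ubnP (d v); elim: n v => // n IH v hv.
have [->//|/hi[e he]] := eqVneq v (source G).
have := hd e; rewrite he => hlt.
apply: leq_trans (ltnW hlt); apply: IH; lia.
Qed.

Lemma dag_source_in G (e : edge G) : dag G -> etgt e != source G.
Proof.
move=> [[d hd] hi ho]; apply/eqP=> he.
by have := hd e; rewrite he ltnNge (source_minimal hd hi).
Qed.

Lemma dag_sink_out G (e : edge G) : dag G -> esrc e != sink G.
Proof. by move=> /dag_rev; exact: (@dag_source_in (rev_graph G) e). Qed.

Lemma dag_loopless G (e : edge G) : dag G -> esrc e != etgt e.
Proof. by move=> [[d hd] _ _]; apply: contraTneq (hd e) => ->; rewrite ltnn. Qed.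

Lemma walk_of_path G x p :
  path [rel u v | [exists e : edge G, (esrc e == u) && (etgt e == v)]] x p ->
  exists2 es : seq (edge G), walk x es (last x p) & map etgt es = p.
Proof.
elim: p x => [|y p IH] x /=; first by exists [::]; rewrite /= ?eqxx.
case/andP=> /existsP[e /andP[/eqP he /eqP hy]] /IH[es hes hp].
by exists (e :: es); rewrite /= ?he ?hy ?eqxx ?hp.
Qed.

Lemma walk_leaves G (x y v : vert G) p :
  walk x p y -> v \in x :: map etgt p -> v != y -> exists e : edge G, esrc e = v.
Proof.
elim: p x => [|e p IH] x /=.
  by move=> /eqP->; rewrite inE => /eqP-> /eqP.
case/andP=> /eqP he hw; rewrite inE => /orP[/eqP-> _|hv]; first by exists e.
exact: IH hw hv.
Qed.

Lemma tdag_dag G : tdag G -> dag G.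
Proof.
move=> [[_ hv _] hac].
pose R := [rel u v | [exists e : edge G, (esrc e == u) && (etgt e == v)]].
split=> [|v hvs|v hvt].
(* The rank counts the vertices that reach [v]. The head of [e] is counted for itself but not for
   the tail, since a path from the head to the tail would close a cycle. *)
- exists (fun v => #|[set u | connect R u v]|) => e.
  have hR : R (esrc e) (etgt e) by apply/existsP; exists e; rewrite !eqxx.
  apply: proper_card; apply/properP; split.
    by apply/subsetP=> u; rewrite !inE => hu; exact: connect_trans hu (connect1 hR).
  exists (etgt e); rewrite inE ?connect0 //; apply/negP=> /connectP[p hp].
  case/shortenP: hp => q hq /= uq _ hlast.
  have [es hes hm] := walk_of_path hq.
  have := hac (esrc e) (e :: es).
  rewrite /dcycle /= eqxx hm uq /= andbT.
  by move: hes; rewrite -hlast => ->.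
- have [p _] := hv v; rewrite inE (negPf hvs) /= => /mapP[e _ ->].
  by exists e.
- have [p /andP[hw _] hin] := hv v; exact: walk_leaves hw hin hvt.
Qed.

(** * Contractions *)

(** [contract_edge] names the merged vertex after the tail of [e], which is not invariant under
    reversal. Describing the contraction by embeddings [rho] and [iota] into [G] makes it
    transferable to reversed and to isomorphic graphs. *)
Record contraction (G : mgraph) (e : edge G) (H : mgraph)
    (rho : vert H -> vert G) (iota : edge H -> edge G) : Prop := Contraction {
  contr_vinj : injective rho;
  contr_vim : forall v, v != etgt e -> exists w, rho w = v;
  contr_vne : forall w, rho w != etgt e;
  contr_einj : injective iota;
  contr_eim : forall e1, e1 != e -> exists e2, iota e2 = e1;
  contr_ene : forall e2, iota e2 != e;
  contr_src : forall e2, rho (esrc e2) =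
    if esrc (iota e2) == etgt e then esrc e else esrc (iota e2);
  contr_tgt : forall e2, rho (etgt e2) =
    if etgt (iota e2) == etgt e then esrc e else etgt (iota e2);
  contr_source : rho (source H) =
    if source G == etgt e then esrc e else source G;
  contr_sink : rho (sink H) = if sink G == etgt e then esrc e else sink G
}.

Lemma val_merge_ends G (e : edge G) (he : esrc e != etgt e) x :
  val (merge_ends he x) = if x == etgt e then esrc e else x.
Proof. by rewrite /merge_ends val_insubd /=; case: eqP. Qed.

Lemma contraction_contract G (e : edge G) (he : esrc e != etgt e) :
  @contraction G e (contract_edge he) val val.
Proof.
split=> //=; rewrite ?val_merge_ends //; try exact: val_inj.
- by move=> v hv; exists (exist _ v hv).
- by move=> [w hw].
- by move=> e1 h1; exists (exist _ e1 h1).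
- by move=> [w hw].
- by move=> e2; rewrite val_merge_ends.
- by move=> e2; rewrite val_merge_ends.
Qed.

(** In the reversed graph the tail of [e] is [etgt e], so the merged vertex has to be renamed from
    [esrc e] to [etgt e]. *)
Lemma contraction_contract_rev G (e : edge G) (he : esrc e != etgt e) :
  @contraction (rev_graph G) e (rev_graph (contract_edge he))
    (fun x => if val x == esrc e then etgt e else val x) val.
Proof.
have hm x : (if val (merge_ends he x) == esrc e then etgt e
             else val (merge_ends he x)) = if x == esrc e then etgt e else x.
  rewrite val_merge_ends; have [->|hx] := eqVneq x (etgt e).
    by rewrite eqxx; case: eqP.
  by case: eqP.
split=> //=; rewrite ?hm //; try exact: val_inj.
- move=> [x hx] [y hy] /= hxy; apply: val_inj => /=; move: hxy hx hy.
  by case: eqP => [->|_]; case: eqP => [->|_] // ->; rewrite eqxx.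
- move=> v hv; have [->|hve] := eqVneq v (etgt e).
    by exists (exist (fun x => x != etgt e) (esrc e) he); rewrite /= eqxx.
  by exists (exist _ v hve); rewrite /= (negPf hv).
- by move=> [w hw] /=; case: (eqVneq w) => // _; rewrite eq_sym.
- by move=> e1 h1; exists (exist _ e1 h1).
- by move=> [w hw].
- by move=> e2; rewrite hm.
- by move=> e2; rewrite hm.
Qed.

Section ContractionTheory.
Variables (G : mgraph) (e : edge G) (H : mgraph).
Variables (rho : vert H -> vert G) (iota : edge H -> edge G).
Hypothesis hc : contraction e rho iota.
Hypothesis hG : dag G.
Hypothesis indeg1 : forall e1 : edge G, etgt e1 = etgt e -> e1 = e.

Lemma contr_tgt_neq e2 : etgt (iota e2) != etgt e.
Proof. by apply/eqP=> /indeg1 /eqP; rewrite (negPf (contr_ene hc e2)). Qed.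

Lemma contr_tgtE e2 : rho (etgt e2) = etgt (iota e2).
Proof. by rewrite (contr_tgt hc) (negPf (contr_tgt_neq e2)). Qed.

Lemma contr_sourceE : rho (source H) = source G.
Proof.
by rewrite (contr_source hc) eq_sym (negPf (dag_source_in e hG)).
Qed.

Lemma contr_out v (e1 : edge G) :
  esrc e1 = rho v -> e1 != e -> exists2 e2, iota e2 = e1 & esrc e2 = v.
Proof.
move=> h1 /(contr_eim hc)[e2 he2]; exists e2 => //; apply: (contr_vinj hc).
by rewrite (contr_src hc) he2 h1 (negPf (contr_vne hc v)).
Qed.

Lemma contr_in v (e1 : edge G) :
  etgt e1 = rho v -> exists2 e2, iota e2 = e1 & etgt e2 = v.
Proof.
move=> h1; have [he1|/(contr_eim hc)[e2 he2]] := eqVneq e1 e.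
  by have := contr_vne hc v; rewrite -h1 he1 eqxx.
by exists e2 => //; apply: (contr_vinj hc); rewrite contr_tgtE he2.
Qed.

Lemma contr_moved v (e1 : edge G) :
  rho v = esrc e -> esrc e1 = etgt e -> exists2 e2, iota e2 = e1 & esrc e2 = v.
Proof.
move=> hv h1; have [he1|/(contr_eim hc)[e2 he2]] := eqVneq e1 e.
  by have := dag_loopless e hG; rewrite -h1 he1 eqxx.
exists e2 => //; apply: (contr_vinj hc).
by rewrite (contr_src hc) he2 h1 eqxx.
Qed.

Lemma contr_sink_neq v : v != sink H -> rho v != sink G.
Proof.
move=> hv; apply/eqP=> hvs; case/eqP: hv; apply: (contr_vinj hc).
by rewrite hvs (contr_sink hc) -hvs (negPf (contr_vne hc v)).
Qed.

Lemma contr_sink_tgt v : v != sink H -> rho v = esrc e -> etgt e != sink G.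
Proof.
move=> hv hve; apply/eqP=> hvs; case/eqP: hv; apply: (contr_vinj hc).
by rewrite hve (contr_sink hc) hvs eqxx.
Qed.

Lemma dag_contraction : dag H.
Proof.
have [[d hd] hi ho] := hG; split=> [|v hv|v hv].
- exists (d \o rho) => e2 /=; rewrite contr_tgtE (contr_src hc).
  case: eqP => [hs|_]; last exact: hd.
  by have := hd e; have := hd (iota e2); rewrite hs; lia.
- have [|e1 he1] := hi (rho v).
    by rewrite -contr_sourceE (inj_eq (contr_vinj hc)).
  by have [e2 _ <-] := contr_in he1; exists e2.
- have [e1 he1] := ho (rho v) (contr_sink_neq hv).
  (* If the contracted edge was the one found, an edge leaving its head replaces it, as it now
     leaves the merged vertex. *)
  have [heq|hne] := eqVneq e1 e; last first.
    by have [e2 _ <-] := contr_out he1 hne; exists e2.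
  have hve : rho v = esrc e by rewrite -he1 heq.
  have [e3 he3] := ho _ (contr_sink_tgt hv hve).
  by have [e2 _ <-] := contr_moved hve he3; exists e2.
Qed.

End ContractionTheory.

Lemma dag_delete G (e : edge G) :
  dag G -> 1 < outdeg (esrc e) -> 1 < indeg (etgt e) -> dag (delete_edge e).
Proof.
move=> [[d hd] hi ho] hout hin; split=> [|v hv|v hv].
- by exists d => e1; exact: hd.
- have [e1 he1] := hi v hv.
  have [heq|hne] := eqVneq e1 e; last by exists (exist _ e1 hne).
  case/card_gt1P: hin => x [y]; rewrite !inE => -[/eqP hx /eqP hy hxy].
  have [hxe|hxe] := eqVneq x e; last by exists (exist _ x hxe); rewrite /= hx -heq.
  have hye : y != e by rewrite -hxe eq_sym.
  by exists (exist _ y hye); rewrite /= hy -heq.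
- have [e1 he1] := ho v hv.
  have [heq|hne] := eqVneq e1 e; last by exists (exist _ e1 hne).
  case/card_gt1P: hout => x [y]; rewrite !inE => -[/eqP hx /eqP hy hxy].
  have [hxe|hxe] := eqVneq x e; last by exists (exist _ x hxe); rewrite /= hx -heq.
  have hye : y != e by rewrite -hxe eq_sym.
  by exists (exist _ y hye); rewrite /= hy -heq.
Qed.

(** * Models *)

Inductive role : Type := Free | In | Root | Out.

Definition inward (r : role) : bool :=
  match r with In | Root => true | _ => false end.

Definition outward (r : role) : bool :=
  match r with Out | Root => true | _ => false end.

Definition rev_role (r : role) : role :=
  match r with In => Out | Out => In | _ => r end.

(* The branch set of a vertex [x] of [P] consists of the vertices [v] with
   [mu v = x] that are not [Free]: an in-tree and an out-tree with a common root.
   Unused edges are labelled [None], the edges of the trees [Some None] and the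
   edge representing [f] is labelled [Some (Some f)]. *)
Record model (P G : mgraph) (tag : vert G -> role) (mu : vert G -> vert P)
    (kap : edge G -> option (option (edge P))) : Prop := Model {
  own_src : forall e f, kap e = Some (Some f) ->
    outward (tag (esrc e)) /\ mu (esrc e) = esrc f;
  own_tgt : forall e f, kap e = Some (Some f) ->
    inward (tag (etgt e)) /\ mu (etgt e) = etgt f;
  own_ex : forall f, exists e, kap e = Some (Some f);
  own_uniq : forall e e1 f,
    kap e = Some (Some f) -> kap e1 = Some (Some f) -> e = e1;
  tree_edge : forall e, kap e = Some None ->
    mu (esrc e) = mu (etgt e) /\
    (tag (esrc e) = In /\ inward (tag (etgt e)) \/
     outward (tag (esrc e)) /\ tag (etgt e) = Out);
  in_uniq : forall e e1, kap e <> None -> kap e1 <> None ->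
    esrc e1 = esrc e -> tag (esrc e) = In -> e1 = e;
  out_uniq : forall e e1, kap e <> None -> kap e1 <> None ->
    etgt e1 = etgt e -> tag (etgt e) = Out -> e1 = e;
  ear_out : forall v, tag v <> Free -> v != sink G ->
    exists2 e, kap e <> None & esrc e = v;
  ear_in : forall v, tag v <> Free -> v != source G ->
    exists2 e, kap e <> None & etgt e = v;
  root_ex : forall x, exists v, tag v = Root /\ mu v = x;
  root_uniq : forall v w, tag v = Root -> tag w = Root -> mu v = mu w -> v = w;
  root_source : tag (source G) = Root /\ mu (source G) = source P;
  root_sink : tag (sink G) = Root /\ mu (sink G) = sink P
}.

Definition has_model (P G : mgraph) : Prop :=
  exists (tag : vert G -> role) mu kap, @model P G tag mu kap.

Lemma model_rev P G tag mu kap : @model P G tag mu kap ->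
  @model (rev_graph P) (rev_graph G) (rev_role \o tag) mu kap.
Proof.
move=> [h1 h2 h3 h4 h5 h6 h7 h8 h9 h10 h11 [h12 h13] [h14 h15]].
split=> /=; rewrite ?h12 ?h14 //.
- by move=> e f /h2[]; case: (tag _).
- by move=> e f /h1[]; case: (tag _).
- move=> e /h5[-> h]; split=> //.
  by case: h => -[]; case: (tag (esrc e)); case: (tag (etgt e)) => //=; auto.
- by move=> e e1 u u1 he hr; apply: h7 => //; move: hr; case: (tag _).
- by move=> e e1 u u1 he hr; apply: h6 => //; move: hr; case: (tag _).
- by move=> v hr; apply: h9 => hv; rewrite hv in hr.
- by move=> v hr; apply: h8 => hv; rewrite hv in hr.
- by move=> x; have [v [hv <-]] := h10 x; exists v; rewrite hv.
- by move=> v w hv hw; apply: h11; move: hv hw; case: (tag v); case: (tag w).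
Qed.

Lemma has_model_rev P G : has_model P G -> has_model (rev_graph P) (rev_graph G).
Proof.
move=> [tag [mu [kap h]]]; exists (rev_role \o tag), mu, kap; exact: model_rev.
Qed.

Section ModelTheory.
Variables (P G : mgraph) (tag : vert G -> role) (mu : vert G -> vert P).
Variable kap : edge G -> option (option (edge P)).
Hypothesis hM : @model P G tag mu kap.

Lemma used_src e : kap e <> None -> tag (esrc e) <> Free.
Proof.
case hk: (kap e) => [[f|]|] // _.
  by have [] := own_src hM hk; case: (tag _).
by have [_ [[->]|[]]] := tree_edge hM hk; case: (tag _).
Qed.

Lemma used_tgt e : kap e <> None -> tag (etgt e) <> Free.
Proof.
case hk: (kap e) => [[f|]|] // _.
  by have [] := own_tgt hM hk; case: (tag _).
by have [_ [[_]|[_ ->]]] := tree_edge hM hk; [case: (tag _)|].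
Qed.

Lemma model_delete e : kap e = None -> has_model P (delete_edge e).
Proof.
move=> hk; have used e1 : kap e1 <> None -> e1 != e.
  by move=> h; apply/eqP=> he; rewrite he in h.
exists tag, mu, (kap \o val).
split=> //=; try by case: hM.
- by move=> e1 f; exact: own_src.
- by move=> e1 f; exact: own_tgt.
- move=> f; have [e1 he1] := own_ex hM f.
  have h1 : e1 != e by apply: used; rewrite he1.
  by exists (exist _ e1 h1).
- by move=> e1 e2 f h1 h2; apply: val_inj; exact: (own_uniq hM h1 h2).
- by move=> e1; exact: tree_edge.
- by move=> e1 e2 h1 h2 h3 h4; apply: val_inj; exact: (in_uniq hM h1 h2 h3 h4).
- by move=> e1 e2 h1 h2 h3 h4; apply: val_inj; exact: (out_uniq hM h1 h2 h3 h4).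
- move=> v h1 h2; have [e1 he1 hs] := ear_out hM h1 h2.
  by exists (exist _ e1 (used e1 he1)).
- move=> v h1 h2; have [e1 he1 hs] := ear_in hM h1 h2.
  by exists (exist _ e1 (used e1 he1)).
Qed.

(** A free head carries no used edge. Otherwise the head is a child in an out-tree, and its parent,
    which lies in the same branch set, takes over its edges. The merged vertex keeps the role of the
    tail in both cases. *)
Lemma model_contraction e H (rho : vert H -> vert G) iota :
  contraction e rho iota -> dag G ->
  (forall e1 : edge G, etgt e1 = etgt e -> e1 = e) ->
  tag (etgt e) = Free /\ kap e = None \/ tag (etgt e) = Out /\ kap e = Some None ->
  has_model P H.
Proof.
move=> hc hG hind hcase.
have hnroot : tag (etgt e) <> Root by case: hcase => -[->].
have hnown f : kap e <> Some (Some f) by case: hcase => -[_ ->].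
have htree : kap e <> None ->
    [/\ tag (etgt e) = Out, outward (tag (esrc e)) & mu (esrc e) = mu (etgt e)].
  case: hcase => -[ht hk] h; first by case: h.
  by have [-> [[_]|[-> _]]] := tree_edge hM hk; rewrite ht.
have hmoved e1 : kap e1 <> None -> esrc e1 = etgt e ->
    [/\ tag (etgt e) = Out, outward (tag (esrc e)) & mu (esrc e) = mu (etgt e)].
  move=> h1 h2; apply: htree; case: hcase => -[ht hk]; last by rewrite hk.
  by have := used_src h1; rewrite h2 ht.
have htgt := contr_tgtE hc hind.
have hroot v : tag v = Root -> exists w, rho w = v.
  by move=> hv; apply: (contr_vim hc); apply/eqP=> hve; apply: hnroot; rewrite -hve.
exists (tag \o rho), (mu \o rho), (kap \o iota); split; rewrite /=.
- move=> e2 f hk; have [h1 h2] := own_src hM hk.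
  rewrite (contr_src hc); case: eqP => // hs.
  by have [||_ -> ->] := hmoved (iota e2); rewrite ?hk // -hs.
- by move=> e2 f hk; rewrite htgt; exact: own_tgt hk.
- move=> f; have [e1 he1] := own_ex hM f.
  have [|e2 he2] := contr_eim hc (e1 := e1); last by exists e2; rewrite he2.
  by apply/eqP=> he; apply: (hnown f); rewrite -he.
- by move=> e1 e2 f h1 h2; apply: (contr_einj hc); exact: (own_uniq hM h1 h2).
- move=> e2 hk; have [h1 h2] := tree_edge hM hk.
  rewrite htgt (contr_src hc); case: eqP => // hs.
  have [||ht ho hmu] := hmoved (iota e2); rewrite ?hk // ho hmu -hs; split=> //.
  by right; case: h2 => -[]; rewrite hs ht.
- move=> e1 e2 h1 h2 hs ht; apply: (contr_einj hc).
  have hsrc e3 : kap (iota e3) <> None -> tag (rho (esrc e3)) = In ->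
      esrc (iota e3) = rho (esrc e3).
    move=> h3; rewrite (contr_src hc); case: eqP => // hs3.
    by have [||_] := hmoved (iota e3) => //; case: (tag _).
  apply: (in_uniq hM) => //; rewrite !hsrc ?hs //.
- move=> e1 e2 h1 h2 hs ht; apply: (contr_einj hc).
  by apply: (out_uniq hM); rewrite -?htgt ?hs.
- move=> v hv hvs; have [e1 hu he1] := ear_out hM hv (contr_sink_neq hc hvs).
  have [heq|hne] := eqVneq e1 e; last first.
    by have [e2 he2 hs] := contr_out hc he1 hne; exists e2; rewrite ?he2.
  have hve : rho v = esrc e by rewrite -he1 heq.
  have [|e3 hu3 he3] := ear_out hM (v := etgt e) _ (contr_sink_tgt hc hvs hve).
    by apply: used_tgt; rewrite -heq.
  by have [e2 he2 hs] := contr_moved hc hG hve he3; exists e2; rewrite ?he2.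
- move=> v hv hvs; have [|e1 hu he1] := ear_in hM hv.
    by rewrite -(contr_sourceE hc hG) (inj_eq (contr_vinj hc)).
  by have [e2 he2 hs] := contr_in hc hind he1; exists e2; rewrite ?he2.
- move=> x; have [v [hv <-]] := root_ex hM x.
  by have [w hw] := hroot v hv; exists w; rewrite hw.
- by move=> v w h1 h2 h3; apply: (contr_vinj hc); exact: (root_uniq hM h1 h2 h3).
- by rewrite (contr_sourceE hc hG); exact: root_source hM.
- have [hs ht] := root_sink hM; rewrite (contr_sink hc); case: eqP => [hse|_] //.
  by case: hnroot; rewrite -hse.
Qed.

Lemma model_iso : dag G ->
  (forall e, exists f, kap e = Some (Some f)) -> graph_iso G P.
Proof.
move=> [_ hi ho] /fin_all_exists[g hg].
have hused e : kap e <> None by rewrite hg.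
have hroot v : tag v = Root.
  have [->|/hi[e he]] := eqVneq v (source G); first by have [] := root_source hM.
  have [->|/ho[e1 he1]] := eqVneq v (sink G); first by have [] := root_sink hM.
  have [h1 _] := own_tgt hM (hg e); have [h2 _] := own_src hM (hg e1).
  by move: h1 h2; rewrite he he1; case: (tag v).
have [r hr] := fin_all_exists (root_ex hM).
have [g1 hg1] := fin_all_exists (own_ex hM).
have [_ hs] := root_source hM; have [_ ht] := root_sink hM.
exists mu, g; split=> //; first split.
- exists r => [v|x]; last by have [] := hr x.
  by apply: (root_uniq hM) => //; have [] := hr (mu v).
- exists g1 => [e|f]; first by exact: (own_uniq hM (hg1 _) (hg e)).
  by have := hg (g1 f); rewrite hg1 => -[].
- by move=> e; have [_ ->] := own_src hM (hg e).
- by move=> e; have [_ ->] := own_tgt hM (hg e).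
Qed.

End ModelTheory.

Lemma d_minor_step P G H : minor_step G H -> d_minor P H -> d_minor P G.
Proof.
by move=> hs [K hK hi]; exists K => //; apply: rt_trans hK; exact: rt_step.
Qed.

Lemma outdeg_gt1 G (e e1 : edge G) :
  e1 != e -> esrc e1 = esrc e -> 1 < outdeg (esrc e).
Proof.
by move=> hne hs; apply/card_gt1P; exists e1, e; rewrite !inE hs eqxx.
Qed.

Lemma indeg_gt1 G (e e1 : edge G) :
  e1 != e -> etgt e1 = etgt e -> 1 < indeg (etgt e).
Proof.
by move=> hne hs; apply/card_gt1P; exists e1, e; rewrite !inE hs eqxx.
Qed.

Lemma outdeg1P G (e : edge G) :
  reflect (forall e1 : edge G, esrc e1 = esrc e -> e1 = e) (outdeg (esrc e) == 1).
Proof.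
apply: (iffP cards1P) => [[x hx] e1 h1|h].
  have := in_set1 e x; have := in_set1 e1 x; rewrite -hx !inE h1 eqxx.
  by move=> /esym/eqP-> /esym/eqP->.
exists e; apply/setP=> e1; rewrite !inE.
by apply/eqP/eqP=> [/h|->].
Qed.

Lemma indeg1P G (e : edge G) :
  reflect (forall e1 : edge G, etgt e1 = etgt e -> e1 = e) (indeg (etgt e) == 1).
Proof. exact: (@outdeg1P (rev_graph G)). Qed.

Lemma card_edge_delete G (e : edge G) : #|{: {f : edge G | f != e}}| < #|edge G|.
Proof.
rewrite card_sig (@eq_card _ _ (predC1 e)) // cardC1 ltn_predL.
by apply/card_gt0P; exists e.
Qed.

(** Each step removes an edge and keeps a model, until only representing edges are left and
    [model_iso] applies. *)
Lemma model_d_minor P G : dag G -> has_model P G -> d_minor P G.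
Proof.
have [n] := ubnP #|edge G|; elim: n G => // n IH G hn hG [tag [mu [kap hM]]].
have [[d hd] hi ho] := hG.
have del (e : edge G) : kap e = None ->
    1 < outdeg (esrc e) -> 1 < indeg (etgt e) -> d_minor P G.
  move=> hk h1 h2; apply: d_minor_step (Deletion h1 h2) _.
  apply: IH; first exact: leq_trans (card_edge_delete e) hn.
    exact: dag_delete.
  exact: model_delete hM _ hk.
have con (e : edge G) : indeg (etgt e) == 1 ->
    tag (etgt e) = Free /\ kap e = None \/ tag (etgt e) = Out /\ kap e = Some None ->
    d_minor P G.
  move=> h1 h2; have he := dag_loopless e hG.
  have /indeg1P hind := h1.
  apply: d_minor_step (BackwardContraction he (eqP h1)) _.
  apply: IH; first exact: leq_trans (card_edge_delete e) hn.
    exact: dag_contraction (contraction_contract he) hG hind.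
  exact: model_contraction hM _ _ _ _ (contraction_contract he) hG hind h2.
have [|hno] := boolP [exists v, if tag v is Free then true else false].
  case/existsP=> v0 hv0.
  (* The edges entering a free vertex of least rank come from branch sets, so their tails have
     another, used edge by [ear_out]. Such an edge can be deleted, or contracted if it is the only
     one entering. *)
  have [v hv hmin] := @arg_minnP _ v0 (fun v => if tag v is Free then true else false) d hv0.
  have hfree : tag v = Free by move: hv; case: (tag v).
  have hvs : v != source G.
    by apply/eqP=> hvs; have [] := root_source hM; rewrite -hvs hfree.
  have [e he] := hi v hvs.
  have hsrc : tag (esrc e) <> Free.
    move=> hsf; have := hmin (esrc e); rewrite hsf => /(_ isT).
    by have := hd e; rewrite he; lia.
  have hk : kap e = None.
    case hk: (kap e) => //; have [|] := used_tgt hM (e := e); first by rewrite hk.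
    by rewrite he.
  have [h1|h1] := boolP (indeg (etgt e) == 1).
    by apply: con h1 _; left; rewrite he.
  apply: (del e hk).
    have [e1 hu he1] := ear_out hM hsrc (dag_sink_out e hG).
    by apply: outdeg_gt1 he1; apply/eqP=> h; rewrite h in hu.
  rewrite ltn_neqAle eq_sym h1 /=; apply/card_gt0P; exists e.
  by rewrite inE.
have tagged v : tag v <> Free.
  by move=> hv; case/existsP: hno; exists v; rewrite hv.
have [/existsP[e /eqP hk]|hno1] := boolP [exists e, kap e == None].
  apply: (del e hk).
    have [e1 hu he1] := ear_out hM (tagged _) (dag_sink_out e hG).
    by apply: outdeg_gt1 he1; apply/eqP=> h; rewrite h in hu.
  have [e1 hu he1] := ear_in hM (tagged _) (dag_source_in e hG).
  by apply: indeg_gt1 he1; apply/eqP=> h; rewrite h in hu.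
have used e : kap e <> None.
  by move=> hk; case/existsP: hno1; exists e; rewrite hk.
have [/existsP[e /eqP hk]|hno2] := boolP [exists e, kap e == Some None]; last first.
  exists G; first exact: rt_refl.
  apply: (model_iso hM hG) => e.
  case hk: (kap e) (used e) => [[f|]|] // _; first by exists f.
  by case/existsP: hno2; exists e; rewrite hk.
(* Now every edge is used, so [out_uniq] gives an [Out] head indegree 1 and [in_uniq] gives an [In]
   tail outdegree 1. *)
have [_ [[ht _]|[_ ht]]] := tree_edge hM hk; last first.
  apply: (con e); last by right.
  by apply/indeg1P=> e1 he1; exact: (out_uniq hM _ _ he1 ht).
have he := dag_loopless e hG.
have hind : forall e1 : edge G, esrc e1 = esrc e -> e1 = e.
  by move=> e1 he1; exact: (in_uniq hM _ _ he1 ht).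
have hout : outdeg (esrc e) = 1 by apply/eqP/outdeg1P.
apply: d_minor_step (ForwardContraction he hout) _.
have hcr := contraction_contract_rev he.
apply: IH; first exact: leq_trans (card_edge_delete e) hn.
  exact: (dag_rev (dag_contraction hcr (dag_rev hG) hind)).
rewrite -[P]rev_graphK -[contract_edge he]rev_graphK; apply: has_model_rev.
by apply: (model_contraction (model_rev hM) hcr (dag_rev hG) hind); right; rewrite /= ht.
Qed.

(** * Models and embeddings *)

Lemma has_model_refl P : dag P -> has_model P P.
Proof.
move=> [_ hi ho]; exists (fun=> Root), id, (fun e => Some (Some e)).
split=> //=.
- by move=> e f [->].
- by move=> e f [->].
- by move=> f; exists f.
- by move=> e e1 f [->] [->].
- by move=> v _ /ho[e <-]; exists e.
- by move=> v _ /hi[e <-]; exists e.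
- by move=> x; exists x.
Qed.

Lemma has_model_iso P G H : graph_iso G H -> has_model P H -> has_model P G.
Proof.
move=> [f [g [[bf bg] hs ht hsou hsnk]]] [tag [mu [kap hM]]].
have [f1 fK f1K] := bf; have [g1 gK g1K] := bg.
exists (tag \o f), (mu \o f), (kap \o g); split=> /=.
- by move=> e x; rewrite -hs; exact: own_src.
- by move=> e x; rewrite -ht; exact: own_tgt.
- by move=> x; have [e he] := own_ex hM x; exists (g1 e); rewrite g1K.
- by move=> e e1 x h h1; apply: (bij_inj bg); exact: (own_uniq hM h h1).
- by move=> e; rewrite -hs -ht; exact: tree_edge.
- move=> e e1 h h1 hee; rewrite -hs => hr; apply: (bij_inj bg).
  by apply: (in_uniq hM h h1 _ hr); rewrite !hs hee.
- move=> e e1 h h1 hee; rewrite -ht => hr; apply: (bij_inj bg).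
  by apply: (out_uniq hM h h1 _ hr); rewrite !ht hee.
- move=> v hv hvs; have [|e he hev] := ear_out hM hv.
    by rewrite -hsnk (inj_eq (bij_inj bf)).
  exists (g1 e); rewrite ?g1K //; apply: (bij_inj bf).
  by rewrite -hs g1K.
- move=> v hv hvs; have [|e he hev] := ear_in hM hv.
    by rewrite -hsou (inj_eq (bij_inj bf)).
  exists (g1 e); rewrite ?g1K //; apply: (bij_inj bf).
  by rewrite -ht g1K.
- by move=> x; have [v hv] := root_ex hM x; exists (f1 v); rewrite f1K.
- by move=> v w h1 h2 h3; apply: (bij_inj bf); exact: (root_uniq hM h1 h2 h3).
- by rewrite hsou; exact: (root_source hM).
- by rewrite hsnk; exact: (root_sink hM).
Qed.

Lemma has_model_add P G (a b : vert G) :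
  has_model P G -> has_model P (add_edge a b).
Proof.
move=> [tag [mu [kap hM]]].
exists tag, mu, (fun e => if e is Some e then kap e else None); split=> /=;
  try by case: hM.
- by case=> // e f; exact: own_src.
- by case=> // e f; exact: own_tgt.
- by move=> f; have [e he] := own_ex hM f; exists (Some e).
- by case=> // e [] // e1 f h h1; rewrite (own_uniq hM h h1).
- by case=> // e; exact: tree_edge.
- by case=> // e [] // e1 h h1 hs hr; rewrite (in_uniq hM h h1 hs hr).
- by case=> // e [] // e1 h h1 hs hr; rewrite (out_uniq hM h h1 hs hr).
- by move=> v h1 h2; have [e he hs] := ear_out hM h1 h2; exists (Some e).
- by move=> v h1 h2; have [e he hs] := ear_in hM h1 h2; exists (Some e).
Qed.

(** The new vertex joins the branch set of [a] exactly when a used edge moves to it. If [a] is an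
    [In] vertex, its way to the root then goes through the new vertex; otherwise the new vertex
    becomes a child in the out-tree. *)
Lemma has_model_forward_split P G (a : vert G) (D : {set edge G}) :
  D \subset [set e | esrc e == a] ->
  has_model P G -> has_model P (forward_split a D).
Proof.
move=> /subsetP hD [tag [mu [kap hM]]].
have hDa e : e \in D -> esrc e = a by move/hD; rewrite inE => /eqP.
pose u := [exists e in D, kap e != None].
have uP e : e \in D -> kap e <> None -> u.
  by move=> h1 h2; apply/existsP; exists e; rewrite h1; apply/eqP.
have uE : u -> exists e, [/\ e \in D, kap e <> None & esrc e = a].
  by case/existsP=> e /andP[h1 /eqP h2]; exists e; rewrite hDa.
pose r := match tag a with In => In | _ => Out end.
exists (fun v => if v is Some v then tag v else if u then r else Free).
exists (fun v => if v is Some v then mu v else mu a).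
exists (fun e => if e is Some e then kap e else if u then Some None else None).
split=> /=.
- case=> [e f hk|f]; last by case: ifP.
  have [h1 h2] := own_src hM hk; case: ifP => // he.
  have -> : u by apply: uP he _; rewrite hk.
  by rewrite -(hDa e he) h2 /r -(hDa e he); case: (tag _) h1.
- by case=> [e f hk|f]; [exact: own_tgt hk|case: ifP].
- by move=> f; have [e he] := own_ex hM f; exists (Some e).
- move=> [e|] [e1|] f //=; try by case: ifP.
  by move=> h h1; rewrite (own_uniq hM h h1).
- case=> [e hk|].
    have [h1 h2] := tree_edge hM hk; case: ifP => // he.
    have -> : u by apply: uP he _; rewrite hk.
    move: h1 h2; rewrite /r (hDa e he); split=> //.
    by case: h2 => -[]; case: (tag a) => //; auto.
  case: ifP => // /uE[e [he hk ha]] _; split=> //.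
  have := used_src hM hk; rewrite ha /r.
  by case: (tag a) => //; auto.
- case=> [e|] [e1|] //=.
  + move=> hk hk1; case: ifP => he1; case: ifP => he //.
      move=> _; rewrite (uP e he hk) /r => hr; congr Some.
      apply: (in_uniq hM hk hk1); rewrite !hDa //.
      by move: hr; case: (tag a).
    by case=> hs hr; rewrite (in_uniq hM hk hk1 hs hr).
  + case: ifP => // /uE[e1 [he1 hk1 ha1]] hk _.
    case: ifP => // he [hs] hr; have := in_uniq hM hk hk1.
    by rewrite ha1 hs => /(_ erefl hr) h; rewrite -h he1 in he.
  + case: ifP => // /uE[e [he hk ha]] _ hk1.
    case: ifP => // he1 [hs] hr; have := in_uniq hM hk hk1.
    by rewrite ha hs => /(_ erefl hr) h; rewrite h he in he1.
- case=> [e|] [e1|] //=.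
  by move=> hk hk1 [hs] hr; rewrite (out_uniq hM hk hk1 hs hr).
- case=> [v hv hvs|].
    have [|e he hev] := ear_out hM hv; first by apply: contraNneq hvs => ->.
    have [heD|heD] := boolP (e \in D); last first.
      by exists (Some e); rewrite ?(negPf heD) ?hev.
    by exists None; rewrite ?(uP e heD he) // -hev hDa.
  case: ifP => // /uE[e [he hk ha]] _ _.
  by exists (Some e); rewrite ?he.
- case=> [v hv hvs|].
    have [|e he hev] := ear_in hM hv; first by apply: contraNneq hvs => ->.
    by exists (Some e); rewrite ?hev.
  by case: ifP => // hu _ _; exists None; rewrite ?hu.
- by move=> x; have [v hv] := root_ex hM x; exists (Some v).
- case=> [v|] [w|]; rewrite /r; try by case: (u); case: (tag a).
  by move=> h1 h2 h3; rewrite (root_uniq hM h1 h2 h3).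
- exact: (root_source hM).
- exact: (root_sink hM).
Qed.

Lemma has_model_backward_split P G (b : vert G) (D : {set edge G}) :
  D \subset [set e | etgt e == b] ->
  has_model P G -> has_model P (backward_split b D).
Proof.
move=> hD /has_model_rev/(@has_model_forward_split _ (rev_graph G) b D hD).
by move=> /has_model_rev; rewrite rev_graphK.
Qed.

Lemma d_embedded_model P G : dag P -> d_embedded P G -> has_model P G.
Proof.
move=> hP [H hs hi]; apply: has_model_iso hi _.
suff lift K : clos_refl_trans mgraph embed_step K H ->
    has_model P K -> has_model P H by exact: lift hs (has_model_refl hP).
elim=> {K H hs hP G} [G H [a b _|a D _ _|b D _ _]|//|G H K _ IH1 _ IH2].
- exact: has_model_add.
- exact: has_model_forward_split.
- exact: has_model_backward_split.
- by move/IH1/IH2.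
Qed.

(** * Inverting a minor step *)

Lemma walk_rank G (d : vert G -> nat) x p y :
  (forall e, d (esrc e) < d (etgt e)) -> walk x p y -> d x <= d y.
Proof.
move=> hd; elim: p x => [|e p IH] x /=; first by move/eqP->.
by case/andP=> /eqP <- /IH; apply: leq_trans; exact: ltnW.
Qed.

Lemma dag_minor_step G H : dag G -> minor_step G H -> dag H.
Proof.
move=> hG [e h1 h2|e he /eqP/indeg1P h|e he /eqP/outdeg1P h].
- exact: dag_delete.
- exact: dag_contraction (contraction_contract he) hG h.
- rewrite -[contract_edge he]rev_graphK; apply: dag_rev.
  exact: dag_contraction (contraction_contract_rev he) (dag_rev hG) h.
Qed.

(** The rank of [G], transported to [K], excludes a path from the head of [e] back to its tail. *)
Lemma add_delete G (e : edge G) K : dag G -> graph_iso (delete_edge e) K ->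
  exists2 H, embed_step K H & graph_iso G H.
Proof.
move=> [[d hd] _ _] [f [g [[bf bg] hs ht hsou hsnk]]].
have [f1 fK f1K] := bf; have [g1 gK g1K] := bg.
exists (add_edge (f (esrc e)) (f (etgt e))).
  apply: Addition => -[p /andP[hw _]].
  have := walk_rank (d := d \o f1) _ hw; rewrite /= !fK leqNgt hd /=.
  suff h e1 : d (f1 (esrc e1)) < d (f1 (etgt e1)) by move=> /(_ h).
  by rewrite -(g1K e1) hs ht !fK; exact: hd.
exists f, (fun e1 => omap g (insub e1)); split=> //=; first split=> //.
- exists (fun e2 => if e2 is Some e2 then val (g1 e2) else e) => [e1|[e2|]] /=.
  + by case: insubP => [e2 _ <-|] /=; rewrite ?gK // negbK => /eqP.
  + by rewrite valK /= g1K.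
  + by rewrite insubF ?eqxx.
- by move=> e1; case: insubP => [e2 _ <-|] /=; rewrite ?hs // negbK => /eqP->.
- by move=> e1; case: insubP => [e2 _ <-|] /=; rewrite ?ht // negbK => /eqP->.
Qed.

Lemma contraction_iso G (e : edge G) H K rho iota :
  @contraction G e H rho iota -> graph_iso H K ->
  exists rho' iota', @contraction G e K rho' iota'.
Proof.
move=> [c1 c2 c3 c4 c5 c6 c7 c8 c9 c10] [f [g [[bf bg] hs ht hsou hsnk]]].
have [f1 fK f1K] := bf; have [g1 gK g1K] := bg.
have hs1 e1 : f1 (esrc e1) = esrc (g1 e1) by rewrite -(g1K e1) hs fK gK.
have ht1 e1 : f1 (etgt e1) = etgt (g1 e1) by rewrite -(g1K e1) ht fK gK.
exists (rho \o f1), (iota \o g1); split=> /=; rewrite -?hsou -?hsnk ?fK //.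
- exact: inj_comp c1 (can_inj f1K).
- by move=> v /c2[w <-]; exists (f w); rewrite fK.
- exact: inj_comp c4 (can_inj g1K).
- by move=> v /c5[w <-]; exists (g w); rewrite gK.
- by move=> e2; rewrite hs1.
- by move=> e2; rewrite ht1.
Qed.

Definition split_of (K G : mgraph) : Prop :=
  (exists x D, [/\ x != sink K, D != set0, D \subset [set e | esrc e == x]
                 & graph_iso G (forward_split x D)]) \/
  (exists x D, [/\ x != source K, D != set0, D \subset [set e | etgt e == x]
                 & graph_iso G (backward_split x D)]).

Lemma graph_iso_rev G H : graph_iso G H -> graph_iso (rev_graph G) (rev_graph H).
Proof. by move=> [f [g [b hs ht h1 h2]]]; exists f, g. Qed.

Lemma split_of_rev K G : split_of K G -> split_of (rev_graph K) (rev_graph G).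
Proof.
case=> -[x [D [h1 h2 h3 h4]]]; [right|left]; exists x, D; split=> //;
  exact: (graph_iso_rev h4).
Qed.

Lemma pick_preim (A B : finType) (f : A -> B) a :
  injective f -> [pick a1 | f a1 == f a] = Some a.
Proof.
move=> hf; case: pickP => [a1 /eqP/hf->//|/(_ a)]; by rewrite eqxx.
Qed.

(** The partial inverse of an injection that misses only [b] is a bijection to [option A]. It
    matches the removed vertex and edge of a contraction with the [None] of a split. *)
Lemma pick_preim_bij (A B : finType) (f : A -> B) b :
  injective f -> (forall a, f a != b) -> (forall b1, b1 != b -> exists a, f a = b1) ->
  bijective (fun b1 => [pick a | f a == b1]).
Proof.
move=> hf hne him; exists (oapp f b) => [b1|[a|]] /=.
- have [->|/him[a <-]] := eqVneq b1 b; last by rewrite pick_preim.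
  by case: pickP => // a; rewrite (negPf (hne a)).
- exact: pick_preim.
- by case: pickP => // a; rewrite (negPf (hne a)).
Qed.

(** The new vertex of a forward split is no terminal and has a leaving edge; the head of [e] has
    both properties because it is not the sink. *)
Lemma forward_split_contraction G (e : edge G) K rho iota :
  @contraction G e K rho iota -> dag G ->
  (forall e1 : edge G, etgt e1 = etgt e -> e1 = e) -> etgt e != sink G ->
  split_of K G.
Proof.
move=> hc hG hind hsnk; left.
have [x hx] := contr_vim hc (dag_loopless e hG).
pose D := [set e2 | esrc (iota e2) == etgt e].
have hDx e2 : e2 \in D -> esrc e2 = x.
  rewrite inE => h; apply: (contr_vinj hc).
  by rewrite (contr_src hc) h.
exists x, D; split.
- apply/eqP=> hxs; have := contr_sink hc; rewrite -hxs hx.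
  rewrite eq_sym (negPf hsnk) => h.
  by have := dag_sink_out e hG; rewrite h eqxx.
- have [_ _ ho] := hG; have [e1 he1] := ho _ hsnk.
  have [e2 he2 _] := contr_moved hc hG hx he1.
  by apply/set0Pn; exists e2; rewrite inE he2 he1.
- by apply/subsetP=> e2 /hDx h; rewrite inE h.
have hV v : v != etgt e -> exists2 w, rho w = v & [pick w | rho w == v] = Some w.
  move=> /(contr_vim hc)[w <-]; exists w => //; exact: pick_preim (contr_vinj hc).
have hV0 : [pick w | rho w == etgt e] = None.
  by case: pickP => // w; rewrite (negPf (contr_vne hc w)).
have hE0 : [pick e2 | iota e2 == e] = None.
  by case: pickP => // e2; rewrite (negPf (contr_ene hc e2)).
exists (fun v => [pick w | rho w == v]), (fun e1 => [pick e2 | iota e2 == e1]).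
split=> /=.
- split; [apply: pick_preim_bij (contr_vinj hc) (contr_vne hc) (contr_vim hc)|].
  exact: pick_preim_bij (contr_einj hc) (contr_ene hc) (contr_eim hc).
- move=> e1; have [->|/(contr_eim hc)[e2 <-]] := eqVneq e1 e.
    by rewrite hE0 -hx (pick_preim _ (contr_vinj hc)).
  rewrite (pick_preim _ (contr_einj hc)) inE; have := contr_src hc e2.
  case: (eqVneq (esrc (iota e2)) (etgt e)) => [->|hne] h; first by rewrite hV0.
  by rewrite -h (pick_preim _ (contr_vinj hc)).
- move=> e1; have [->|/(contr_eim hc)[e2 <-]] := eqVneq e1 e.
    by rewrite hE0 hV0.
  rewrite (pick_preim _ (contr_einj hc)) -(contr_tgtE hc hind).
  by rewrite (pick_preim _ (contr_vinj hc)).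
- by rewrite -(contr_sourceE hc hG) (pick_preim _ (contr_vinj hc)).
- have := contr_sink hc; rewrite eq_sym (negPf hsnk) => <-.
  by rewrite (pick_preim _ (contr_vinj hc)).
Qed.

(* If the head of [e] is the sink, the whole graph funnels through [e], so that
   the tail of [e] has outdegree 1 and can be split off backwards instead. *)
Lemma split_of_contraction G (e : edge G) K rho iota rho' iota' :
  @contraction G e K rho iota ->
  @contraction (rev_graph G) e (rev_graph K) rho' iota' -> dag G ->
  (forall e1 : edge G, etgt e1 = etgt e -> e1 = e) -> source K != sink K ->
  split_of K G.
Proof.
move=> hc hcr hG hind hK.
have [hsnk|hsnk] := eqVneq (etgt e) (sink G); last first.
  exact: forward_split_contraction hc hG hind hsnk.
rewrite -[K]rev_graphK -[G]rev_graphK; apply: split_of_rev.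
apply: (forward_split_contraction hcr (dag_rev hG)).
  have [[d hd] _ ho] := hG.
  pose D := \max_v d v; have hD v : d v <= D by exact: leq_bigmax.
  (* A walk from [w] to the sink ends with [e], the only edge entering the sink, so [w] has at most
     the rank of the tail. An edge leaving the tail can therefore only lead to the sink. *)
  have hle w : w != sink G -> d w <= d (esrc e).
    have [n] := ubnP (D - d w); elim: n w => // n IH w hn /ho[e1 he1].
    have [h|h] := eqVneq (etgt e1) (sink G).
      by rewrite -he1 (hind e1) // h hsnk.
    have h1 := hd e1; rewrite he1 in h1; apply: leq_trans (ltnW h1) _.
    by apply: IH h; have := hD (etgt e1); lia.
  move=> e1 he1; apply: hind; rewrite hsnk.
  apply/eqP; apply: contraT => /hle; rewrite leqNgt.
  by have := hd e1; rewrite (he1 : @esrc G e1 = @esrc G e) => ->.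
(* If the tail were the source, [e] would join the terminals and its contraction would identify them
   in [K]. *)
apply/eqP => /= h; case/eqP: hK; apply: (contr_vinj hc).
by rewrite (contr_sourceE hc hG) (contr_sink hc) hsnk eqxx.
Qed.

Lemma embed_minor_step G H K : dag G -> minor_step G H -> graph_iso H K ->
  source K != sink K -> exists2 K', embed_step K K' & graph_iso G K'.
Proof.
move=> hG hs hi hK.
have split : split_of K G -> exists2 K', embed_step K K' & graph_iso G K'.
  case=> -[x [D [h1 h2 h3 h4]]]; eexists; try exact: h4.
    exact: ForwardSplit.
  exact: BackwardSplit.
case: hs hi => [e h1 h2|e he /eqP/indeg1P h|e he /eqP/outdeg1P h] hi.
- exact: add_delete hG hi.
- apply: split; have [r [i hc]] := contraction_iso (contraction_contract he) hi.
  have [r' [i' hc']] := contraction_iso (contraction_contract_rev he) (graph_iso_rev hi).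
  exact: split_of_contraction hc hc' hG h hK.
- apply: split; have [r [i hc]] := contraction_iso (contraction_contract he) hi.
  have [r' [i' hc']] := contraction_iso (contraction_contract_rev he) (graph_iso_rev hi).
  rewrite -[K]rev_graphK -[G]rev_graphK; apply: split_of_rev.
  have hcc : @contraction (rev_graph (rev_graph G)) e (rev_graph (rev_graph K)) r i.
    by case: (G) (K) e r i hc {he h hc' hi r' i'}  => ? ? ? ? ? ? [].
  apply: split_of_contraction hc' hcc (dag_rev hG) h _.
  by rewrite eq_sym.
Qed.

(** The reduction is undone from its last step back. Embedding steps keep the terminals distinct,
    which [embed_minor_step] asks for each time. *)
Lemma d_minor_embedded P G :
  dag G -> source P != sink P -> d_minor P G -> d_embedded P G.
Proof.
move=> hG hP [H hs hi]; have {}hs := clos_rt_rt1n _ _ _ _ hs.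
suff [K [h1 h2 _]] : exists K,
  [/\ clos_refl_trans mgraph embed_step P K, graph_iso G K & source K != sink K].
  by exists K.
elim: hs hG hi => {G H} [G|G H K hs _ IH] hG hi.
  by exists P; split=> //; exact: rt_refl.
have [K1 [h1 h2 h3]] := IH (dag_minor_step hG hs) hi.
have [K2 h4 h5] := embed_minor_step hG hs h2 h3.
exists K2; split=> //; first exact: rt_trans h1 (rt_step _ _ _ _ h4).
by case: h4 h3.
Qed.

Lemma d_minor_modelE P G :
  dag P -> dag G -> source P != sink P -> d_minor P G <-> has_model P G.
Proof.
move=> hP hG h; split; last exact: model_d_minor.
by move/(d_minor_embedded hG h); exact: d_embedded_model.
Qed.

Lemma d_embedded_modelE P G :
  dag P -> dag G -> source P != sink P -> d_embedded P G <-> has_model P G.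
Proof.
move=> hP hG h; split; first exact: d_embedded_model.
by move/(model_d_minor hG); exact: d_minor_embedded.
Qed.

(** * The one-vertex pattern *)

(** The head of an edge is not the source, hence not the sink, so another edge leaves it; no edge
    could have a head of maximal rank. *)
Lemma dag_trivial P : dag P -> source P = sink P ->
  (edge P -> False) /\ (forall v, v = source P).
Proof.
move=> hP hst; have [[d hd] hi ho] := hP.
have he : edge P -> False.
  move=> e0; case: (@arg_maxnP _ e0 xpredT (fun e => d (etgt e))) => // e _ hmax.
  have [|e1 he1] := ho (etgt e).
    by rewrite -hst; exact: dag_source_in.
  by have := hmax e1 isT; have := hd e1; rewrite he1; lia.
by split=> // v; apply/eqP; apply: contraT => /hi[e]; case: (he e).
Qed.

Lemma trivial_iso P G : dag P -> dag G -> source P = sink P ->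
  source G = sink G -> graph_iso G P.
Proof.
move=> hP hG sP sG.
have [eP vP] := dag_trivial hP sP; have [eG vG] := dag_trivial hG sG.
have [g _] : exists g : edge G -> edge P, True.
  by exists (fun e => False_rect (edge P) (eG e)).
have [g1 _] : exists g : edge P -> edge G, True.
  by exists (fun e => False_rect (edge G) (eP e)).
exists (fun=> source P), g; split=> //; try by move=> e; have := eG e.
split; last by exists g1 => e; exfalso; [exact: eG e|exact: eP e].
by exists (fun=> source G) => v; [exact: esym (vG v)|exact: esym (vP v)].
Qed.

(** All edges entering a vertex of least rank among those other than the source come from the
    source. They are parallel: all but one can be deleted and the last one contracted. *)
Lemma d_minor_trivial P G : dag P -> dag G -> source P = sink P -> d_minor P G.
Proof.
move=> hP hG sP; have [n] := ubnP #|edge G|; elim: n G hG => // n IH G hG hn.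
have [sG|sG] := eqVneq (source G) (sink G).
  by exists G; [exact: rt_refl|exact: trivial_iso].
have [[d hd] hi ho] := hG.
case: (@arg_minnP _ (sink G) (fun v => v != source G) d); first by rewrite eq_sym.
move=> v hv hmin; have [e he] := hi v hv.
have hsrc (e1 : edge G) : etgt e1 = v -> esrc e1 = source G.
  move=> h1; apply/eqP; apply: contraT => /hmin.
  by rewrite leqNgt -h1 hd.
have [h1|h1] := boolP (indeg (etgt e) == 1).
  have hl := dag_loopless e hG; have /indeg1P h2 := h1.
  apply: d_minor_step (BackwardContraction hl (eqP h1)) _.
  apply: IH; last exact: leq_trans (card_edge_delete e) hn.
  exact: dag_contraction (contraction_contract hl) hG h2.
have h2 : 1 < indeg (etgt e).
  rewrite ltn_neqAle eq_sym h1 /=; apply/card_gt0P; exists e.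
  by rewrite inE.
have h3 : 1 < outdeg (esrc e).
  case/card_gt1P: h2 => x [y []]; rewrite !inE => /eqP hx /eqP hy hxy.
  by apply/card_gt1P; exists x, y; rewrite !inE !hsrc ?hx ?hy.
apply: d_minor_step (Deletion h3 h2) _; apply: IH; first exact: dag_delete.
exact: leq_trans (card_edge_delete e) hn.
Qed.

(** No embedding step starts from a single vertex: it is both terminals, which forbids splits, and
    it reaches itself by the empty path, which forbids additions. *)
Lemma d_embedded_trivial P G : dag P -> dag G -> source P = sink P ->
  d_embedded P G <-> #|vert G| = 1.
Proof.
move=> hP hG sP; have [eP vP] := dag_trivial hP sP; split; last first.
  move=> /fintype1[x hx]; exists P; first exact: rt_refl.
  by apply: trivial_iso => //; rewrite (hx (source G)) (hx (sink G)).
move=> [H hs [f [g [[bf _] _ _ _ _]]]]; have {}hs := clos_rt_rt1n _ _ _ _ hs.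
suff hH : H = P.
  rewrite (bij_eq_card bf) hH; apply: (@eq_card1 _ (source P)) => v.
  by rewrite (vP v) !inE eqxx.
case: hs => // K H1 hs _; exfalso; case: hs => [a b h|a D h _ _|a D h _ _].
- by apply: h; exists [::]; rewrite /simple_path /= (vP a) (vP b) eqxx.
- by move: h; rewrite (vP a) sP eqxx.
- by move: h; rewrite (vP a) eqxx.
Qed.

(** * The pebble game *)

Definition vnum (G : mgraph) (v : vert G) : nat := enum_rank v.
Definition ednum (G : mgraph) (e : edge G) : nat := enum_rank e.

Section Game.
Variable P : mgraph.
Implicit Types (f g : edge P) (x : vert P) (s : seq nat) (t : nat).

(* A state lists the positions of the roots, then for each edge [f] of [P] the
   stage of its pebble (0: before its start, 1: in the out-tree, 2: on the edge
   representing [f], 3: in the in-tree, 4: finished), then the edge of the host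
   graph on which the pebble lies. *)
Definition state_size : nat := #|vert P| + (#|edge P| + #|edge P|).
Definition root_of x s : nat := nth 0 s (enum_rank x).
Definition stage f s : nat := nth 0 s (#|vert P| + enum_rank f).
Definition place f s : nat := nth 0 s (#|vert P| + (#|edge P| + enum_rank f)).

Definition mkstate (R : vert P -> nat) (k c : edge P -> nat) : seq nat :=
  [seq R x | x <- enum (vert P)] ++
    [seq k f | f <- enum (edge P)] ++ [seq c f | f <- enum (edge P)].

Lemma size_mkstate R k c : size (mkstate R k c) = state_size.
Proof. by rewrite /mkstate !size_cat 3!size_map -!cardE. Qed.

Lemma root_of_mkstate R k c x : root_of x (mkstate R k c) = R x.
Proof.
rewrite /root_of /mkstate nth_cat size_map -cardE ltn_ord (nth_map x) ?nth_enum_rank //.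
by rewrite -cardE.
Qed.

Lemma stage_mkstate R k c f : stage f (mkstate R k c) = k f.
Proof.
rewrite /stage /mkstate nth_cat size_map -cardE ltnNge leq_addr /= addKn.
rewrite nth_cat size_map -cardE ltn_ord (nth_map f) ?nth_enum_rank //.
by rewrite -cardE.
Qed.

Lemma place_mkstate R k c f : place f (mkstate R k c) = c f.
Proof.
rewrite /place /mkstate nth_cat size_map -cardE ltnNge leq_addr /= addKn.
rewrite nth_cat size_map -cardE ltnNge leq_addr /= addKn.
by rewrite (nth_map f) ?nth_enum_rank // -cardE.
Qed.

Lemma all_mkstate (a : pred nat) R k c :
  (forall x, a (R x)) -> (forall f, a (k f)) -> (forall f, a (c f)) ->
  all a (mkstate R k c).
Proof.
move=> hR hk hc; rewrite /mkstate !all_cat !all_map.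
by apply/and3P; split; apply/allP=> i _ /=.
Qed.

Variables (n m : nat) (src tgt lv : nat -> nat) (s0 t0 L : nat).

(** The vertex that the pebble enters next: a waiting pebble is about to enter the root at which it
    starts. The host graph is given by functions on numbers because the program evaluates the game
    on arbitrary tuples. *)
Definition target f s : nat :=
  if stage f s != 0 then tgt (place f s) else root_of (esrc f) s.

Definition visits t f s : bool := (stage f s < 4) && (lv (target f s) == t).

Definition init_ok s : bool :=
  [&& [forall x, root_of x s < n], root_of (source P) s == s0,
      root_of (sink P) s == t0 &
      [forall f, (stage f s == 0) && (place f s == 0)]].

(** A finished pebble has its place reset to 0, the place of a waiting one, so that pebbles that
    start or finish at the same root pass the comparisons of places in [meet_ok]. *)
Definition move_ok t s s' f : bool :=
  [&& (visits t f s && (stage f s < 2)) ==>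
        [&& (stage f s' == 1) || (stage f s' == 2), place f s' < m &
            src (place f s') == target f s],
      (visits t f s && (1 < stage f s)) ==>
        ([&& stage f s' == 3, place f s' < m & src (place f s') == target f s] ||
         [&& stage f s' == 4, place f s' == 0 & target f s == root_of (etgt f) s])
    & ~~ visits t f s ==> (stage f s' == stage f s) && (place f s' == place f s)].

(** The tree conditions, checked where two pebbles meet. In an out-tree they have come by the same
    edge and may part, but not onto a common representing edge; in an in-tree they go on by the same
    edge; an arriving and a departing pebble may share only a root, where one ends and the other
    starts. *)
Definition meet_ok t s s' f g : bool :=
  [&& visits t f s, visits t g s & target f s == target g s] ==>
    [&& ((stage f s < 2) && (stage g s < 2)) ==>
          [&& esrc f == esrc g, stage f s == stage g s, place f s == place g s &
              ~~ [&& stage f s' == 2, stage g s' == 2 & place f s' == place g s']],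
        ((1 < stage f s) && (1 < stage g s)) ==>
          [&& etgt f == etgt g, stage f s' == stage g s' & place f s' == place g s']
      & ((1 < stage f s) && (stage g s < 2)) ==>
          [&& stage f s' == 4, stage g s == 0 & etgt f == esrc g]].

Definition step_ok t s s' : bool :=
  [&& [forall x, root_of x s' == root_of x s], [forall f, move_ok t s s' f] &
      [forall f, forall g, (f != g) ==> meet_ok t s s' f g]].

Definition final_ok s : bool := [forall f, stage f s == 4].

Definition bounded s : bool := (size s == state_size) && all (fun i => i < L) s.

(** At time [t] the levels below [t] have been processed. The entries are bounded by [L] so that
    loops of length [L] enumerate all candidates. *)
Fixpoint reachable t s : Prop :=
  if t is t.+1 then bounded s /\ exists2 s', reachable t s' & step_ok t s' s
  else bounded s /\ init_ok s.

Definition accepted : Prop := exists2 s, reachable L s & final_ok s.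

Lemma reachable_bounded t s : reachable t s -> bounded s.
Proof. by case: t => [|t] []. Qed.

Lemma reachable_run t s : reachable t s -> exists z : nat -> seq nat,
  [/\ z t = s, init_ok (z 0) & forall i, i < t -> step_ok i (z i) (z i.+1)].
Proof.
elim: t s => [|t IH] s /=; first by case=> _ h; exists (fun=> s).
case=> _ [s' /IH[z [hz h0 hs]] hss].
exists (fun i => if i == t.+1 then s else z i); split=> //; first by rewrite eqxx.
move=> i; rewrite ltnS eqSS => hi; rewrite [i == t.+1]ltn_eqF //.
have [->|hne] := eqVneq i t; first by rewrite hz.
by apply: hs; rewrite ltn_neqAle hne.
Qed.

Variable G : mgraph.
Notation N := (@vnum G).
Notation E := (@ednum G).

Hypothesis hn : n = #|vert G|.
Hypothesis hm : m = #|edge G|.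
Hypothesis hsrc : forall e : edge G, src (E e) = N (esrc e).
Hypothesis htgt : forall e : edge G, tgt (E e) = N (etgt e).
Hypothesis hs0 : s0 = N (source G).
Hypothesis ht0 : t0 = N (sink G).
Hypothesis hlv : forall e : edge G, lv (N (esrc e)) < lv (N (etgt e)).
Hypothesis hlvL : forall v : vert G, lv (N v) < L.
Hypothesis hnL : n <= L.
Hypothesis hmL : m <= L.
Hypothesis hL : 4 < L.
Hypothesis hP : dag P.
Hypothesis hPst : source P != sink P.

Let lvl v := lv (N v).

Lemma N_inj : injective N.
Proof. by move=> v w /val_inj/enum_rank_inj. Qed.

Lemma E_inj : injective E.
Proof. by move=> v w /val_inj/enum_rank_inj. Qed.

Lemma N_onto i : i < n -> exists v, i = N v.
Proof.
rewrite hn => hi; exists (enum_val (Ordinal hi)).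
by rewrite /vnum enum_valK.
Qed.

Lemma E_onto i : i < m -> exists v, i = E v.
Proof.
rewrite hm => hi; exists (enum_val (Ordinal hi)).
by rewrite /ednum enum_valK.
Qed.

(** * From a model to an accepting run *)

Section RunOfModel.
Variables (tag : vert G -> role) (mu : vert G -> vert P).
Variable kap : edge G -> option (option (edge P)).
Hypothesis hM : @model P G tag mu kap.
Variables (r : vert P -> vert G) (o : edge P -> edge G).
Hypothesis hr : forall x, tag (r x) = Root /\ mu (r x) = x.
Hypothesis ho : forall f, kap (o f) = Some (Some f).

Definition out_step : rel (vert G) := [rel u v | [exists e,
  [&& kap e == Some None, esrc e == u, etgt e == v &
      if tag v is Out then true else false]]].

(** An [Out] vertex has a used entering edge by [ear_in]. It is not a representing edge, as these
    enter inward vertices, so it comes from a parent of lower level in the out-tree. *)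
Lemma root_connect v : outward (tag v) -> connect out_step (r (mu v)) v.
Proof.
have [k] := ubnP (lvl v); elim: k v => // k IH v hk.
case htv: (tag v) => // _.
  suff -> : r (mu v) = v by exact: connect0.
  by have [h1 h2] := hr (mu v); apply: (root_uniq hM).
have [||e he hev] := ear_in hM (v := v); first by rewrite htv.
  by apply/eqP=> h; have [h1 _] := root_source hM; rewrite -h htv in h1.
case hk': (kap e) he => [[f|]|] // _.
  by have [h1 _] := own_tgt hM hk'; rewrite hev htv in h1.
have [h1 [[_ h2]|[h2 _]]] := tree_edge hM hk'; first by rewrite hev htv in h2.
rewrite -hev -h1; apply: connect_trans (IH (esrc e) _ h2) (connect1 _).
  by have := hlv e; move: hk; rewrite -hev /lvl; lia.
by apply/existsP; exists e; rewrite hk' !eqxx hev htv.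
Qed.

(** A moving pebble lies on an edge that crosses from below level [t] to [t] or above. An out-tree
    branches, so it is recorded that the representing edge can still be reached; in an in-tree the
    way is forced. *)
Inductive pebble_inv t f : nat -> nat -> Prop :=
| Waiting : t <= lvl (r (esrc f)) -> pebble_inv t f 0 0
| InOutTree e : lvl (esrc e) < t -> t <= lvl (etgt e) -> kap e = Some None ->
    tag (etgt e) = Out -> mu (etgt e) = esrc f ->
    connect out_step (etgt e) (esrc (o f)) -> pebble_inv t f 1 (E e)
| OnOwnEdge : lvl (esrc (o f)) < t -> t <= lvl (etgt (o f)) ->
    pebble_inv t f 2 (E (o f))
| InInTree e : lvl (esrc e) < t -> t <= lvl (etgt e) -> kap e = Some None ->
    tag (esrc e) = In -> mu (esrc e) = etgt f -> pebble_inv t f 3 (E e)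
| Finished : pebble_inv t f 4 0.

Lemma next_out v f : outward (tag v) -> mu v = esrc f ->
  connect out_step v (esrc (o f)) ->
  exists k e, [/\ pebble_inv (lvl v).+1 f k (E e), esrc e = v & k = 1 \/ k = 2].
Proof.
move=> h1 h2 /connectP[[|w p] /=].
  move=> _ hv; exists 2, (o f); split=> //; last by right.
  rewrite -hv.
  by apply: OnOwnEdge => //; exact: hlv.
case/andP=> /existsP[e /and4P[/eqP hk /eqP he /eqP hew htw]] hp hl.
have {}htw : tag w = Out by case: (tag w) htw.
exists 1, e; split=> //; last by left.
apply: InOutTree; rewrite ?he ?hew //.
- by have := hlv e; rewrite he hew.
- by have [h3 _] := tree_edge hM hk; rewrite -hew -h3 he.
- by apply/connectP; exists p.
Qed.

Lemma next_in v f : inward (tag v) -> mu v = etgt f ->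
  (tag v = Root /\ v = r (etgt f)) \/
  exists2 e, pebble_inv (lvl v).+1 f 3 (E e) & esrc e = v.
Proof.
move=> h1 h2; case htv: (tag v) h1 => // _; last first.
  left; split=> //; have [h3 h4] := hr (etgt f).
  by apply: (root_uniq hM) => //; rewrite h2.
right; have [||e he hev] := ear_out hM (v := v); first by rewrite htv.
  by apply/eqP=> h; have [h3 _] := root_sink hM; rewrite -h htv in h3.
exists e => //; case hk: (kap e) he => [[g|]|] // _.
  by have [h3 _] := own_src hM hk; rewrite hev htv in h3.
by apply: InInTree; rewrite ?hev //; have := hlv e; rewrite hev.
Qed.

Definition tracks t s : Prop :=
  (forall x, root_of x s = N (r x)) /\ forall f, pebble_inv t f (stage f s) (place f s).

Definition target_vertex t s f v : Prop :=
  [/\ target f s = N v,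
      stage f s = 0 -> v = r (esrc f) /\ place f s = 0,
      stage f s = 1 -> exists e, [/\ place f s = E e, etgt e = v,
        kap e = Some None, tag v = Out & mu v = esrc f]
    & 1 < stage f s -> inward (tag v) /\ mu v = etgt f].

Lemma tracks_target t s f : tracks t s -> stage f s < 4 ->
  exists2 v, target_vertex t s f v & t <= lvl v /\
    (stage f s = 1 -> connect out_step v (esrc (o f))).
Proof.
move=> [hR hI]; rewrite /target_vertex /target.
case: (hI f) => [ht|e h1 h2 h3 h4 h5 h6|h1 h2|e h1 h2 h3 h4 h5|] // _.
- exists (r (esrc f)); split=> //=; by rewrite ?hR.
- exists (etgt e); split=> //=.
  by move=> _; exists e.
- exists (etgt (o f)); split=> //=.
  by move=> _; exact: (own_tgt hM (ho f)).
- exists (etgt e); split=> //=.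
  move=> _; have [h6 [[h7 h8]|[h7 _]]] := tree_edge hM h3.
    by rewrite -h6.
  by rewrite h4 in h7.
Qed.

(** Each pebble chooses its move alone, whence the quantification over all [s'] that extend the
    choice; the moves are assembled in [reachable_model]. *)
Lemma tracks_move t s f : tracks t s -> exists kc : nat * nat,
  pebble_inv t.+1 f kc.1 kc.2 /\
  forall s', stage f s' = kc.1 -> place f s' = kc.2 -> move_ok t s s' f.
Proof.
move=> hT; have [hR hI] := hT.
have [hvis|hvis] := boolP (visits t f s); last first.
  exists (stage f s, place f s); split=> /=; last first.
    by move=> s' h1 h2; rewrite /move_ok (negPf hvis) h1 h2 !eqxx.
  have [h4|h4] := ltnP (stage f s) 4; last first.
    by move: h4; case: (hI f) => // *; exact: Finished.
  move: hvis; rewrite /visits h4 /target.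
  case: (hI f) => [ht|e h1 h2 h3 h5 h6 h7|h1 h2|e h1 h2 h3 h5 h6|] /=;
    rewrite ?hR ?htgt => hne.
  - by apply: Waiting; rewrite ltn_neqAle eq_sym hne.
  - by apply: InOutTree => //; [exact: ltnW|rewrite ltn_neqAle eq_sym hne].
  - by apply: OnOwnEdge => //; [exact: ltnW|rewrite ltn_neqAle eq_sym hne].
  - by apply: InInTree => //; [exact: ltnW|rewrite ltn_neqAle eq_sym hne].
  - exact: Finished.
have /andP[h4 /eqP hlt] := hvis.
have [v [hv hv0 hv1 hv2] [_ hconn]] := tracks_target hT h4.
have hvt : lvl v = t by rewrite /lvl -hv.
have hE (e : edge G) : E e < m by rewrite hm /ednum.
have [h2|h2] := ltnP (stage f s) 2.
  have [||| k [e [hinv hev hk]]] := next_out (v := v) (f := f).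
  - case hst: (stage f s) h2 => [|[|]] // _; first by have [->] := hv0 hst; rewrite (hr _).1.
    by have [e [_ _ _ -> _]] := hv1 hst.
  - case hst: (stage f s) h2 => [|[|]] // _; first by have [->] := hv0 hst; rewrite (hr _).2.
    by have [e [_ _ _ _ ->]] := hv1 hst.
  - case hst: (stage f s) h2 => [|[|]] // _; last exact: hconn.
    have [-> _] := hv0 hst; have [h5 <-] := own_src hM (ho f); exact: root_connect.
  exists (k, E e); rewrite -hvt; split=> // s' /= h5 h6.
  have h7 : (1 < stage f s) = false by rewrite ltnNge -ltnS h2.
  rewrite /move_ok hvt hvis h2 h5 h6 h7 hE hsrc hev hv eqxx /=.
  by case: hk => ->.
have [h5 h6] := hv2 h2.
have [[_ hvr]|[e hinv hev]] := next_in h5 h6.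
  exists (4, 0); split=> /= [|s' h7 h8]; first exact: Finished.
  rewrite /move_ok hvis h7 h8 hv hR hvr !eqxx orbT /= implybT andbT.
  by rewrite [_ < 2]ltnNge h2.
exists (3, E e); rewrite -hvt; split=> // s' /= h7 h8.
by rewrite /move_ok hvt hvis h7 h8 hE hsrc hev hv !eqxx /= implybT [_ < 2]ltnNge h2.
Qed.

Lemma tracks_meet t s s' f g : tracks t s -> tracks t.+1 s' ->
  move_ok t s s' f -> move_ok t s s' g -> f != g -> meet_ok t s s' f g.
Proof.
move=> hT hT' hmf hmg hfg; apply/implyP=> /and3P[vf vg /eqP hh].
have /andP[h4f _] := vf; have /andP[h4g _] := vg.
have [v [hv hv0 hv1 hv2] _] := tracks_target hT h4f.
have [w [hw hw0 hw1 hw2] _] := tracks_target hT h4g.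
have hvw : w = v by apply: N_inj; rewrite -hw -hv.
subst w.
have [_ hI'] := hT'.
have hend (p : edge P) : visits t p s -> 1 < stage p s -> target p s = N v ->
    move_ok t s s' p ->
    (stage p s' = 4 /\ place p s' = 0 /\ tag v = Root) \/
    (stage p s' = 3 /\ tag v = In /\
     exists e, [/\ place p s' = E e, esrc e = v & kap e = Some None]).
  move=> hvp h2 hhp /and3P[_ /implyP]; rewrite hvp h2 => /(_ isT) h _.
  case/orP: h => /and3P[/eqP h5 h6 h7]; [right|left]; split=> //.
    move: h6 h7; have := hI' p; rewrite h5 => hI.
    inversion hI as [| | |e e1 e2 e3 e4 e5 e6 e7|] => h6.
    rewrite hsrc hhp => /eqP /N_inj hes; rewrite -hes e4; split=> //.
    by exists e.
  split; first exact/eqP.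
  move: h7; rewrite hhp; case: hT => hR _; rewrite hR => /eqP /N_inj ->.
  by case: (hr (etgt p)).
have hr0 (p : edge P) : stage p s = 0 ->
    (stage p s = 0 -> v = r (esrc p) /\ place p s = 0) ->
    [/\ tag v = Root, mu v = esrc p & place p s = 0].
  by move=> h /(_ h)[-> ->]; have [-> ->] := hr (esrc p).
apply/and3P; split; apply/implyP=> /andP[h2f h2g].
- have hnot2 : ~~ [&& stage f s' == 2, stage g s' == 2 & place f s' == place g s'].
    apply/negP=> /and3P[/eqP e1 /eqP e2 /eqP e3].
    have := hI' f; have := hI' g; rewrite e1 e2 => i1 i2.
    inversion i1; inversion i2.
    have : E (o f) = E (o g) by congruence.
    move/E_inj => e4; case/eqP: hfg.
    by have := ho f; rewrite e4 ho => -[].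
  rewrite hnot2 andbT.
  case ef: (stage f s) h2f => [|[|]] // _; case eg: (stage g s) h2g => [|[|]] // _.
  + have [_ m1 p1] := hr0 f ef hv0; have [_ m2 p2] := hr0 g eg hw0.
    by rewrite p1 p2 -m1 -m2 !eqxx.
  + have [t1 _ _] := hr0 f ef hv0; have [e [_ _ _ t2 _]] := hw1 eg.
    by rewrite t1 in t2.
  + have [t1 _ _] := hr0 g eg hw0; have [e [_ _ _ t2 _]] := hv1 ef.
    by rewrite t1 in t2.
  + have [e [p1 q1 k1 t1 m1]] := hv1 ef; have [e' [p2 q2 k2 t2 m2]] := hw1 eg.
    have he : e' = e by apply: (out_uniq hM); rewrite ?k1 ?k2 ?q1 ?q2.
    by rewrite p1 p2 he -m1 -m2 !eqxx.
- have [_ m1] := hv2 h2f; have [_ m2] := hw2 h2g.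
  rewrite -m1 -m2 eqxx /=.
  have [[a1 [b1 c1]]|[a1 [b1 [e [c1 d1 k1]]]]] := hend f vf h2f hv hmf;
  have [[a2 [b2 c2]]|[a2 [b2 [e' [c2 d2 k2]]]]] := hend g vg h2g hw hmg.
  + by rewrite a1 a2 b1 b2 !eqxx.
  + by rewrite c1 in b2.
  + by rewrite b1 in c2.
  + have he : e' = e by apply: (in_uniq hM); rewrite ?k1 ?k2 ?d1 ?d2.
    by rewrite a1 a2 c1 c2 he !eqxx.
- have [i1 m1] := hv2 h2f.
  have [a1 [b1 c1]] : stage f s' = 4 /\ place f s' = 0 /\ tag v = Root.
    have [//|[a1 [b1 _]]] := hend f vf h2f hv hmf.
    case eg: (stage g s) h2g => [|[|]] // _.
      by have [t1 _ _] := hr0 g eg hw0; rewrite b1 in t1.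
    by have [e [_ _ _ t2 _]] := hw1 eg; rewrite b1 in t2.
  case eg: (stage g s) h2g => [|[|]] // _.
    by have [_ m2 _] := hr0 g eg hw0; rewrite a1 -m1 -m2 !eqxx.
  by have [e [_ _ _ t2 _]] := hw1 eg; rewrite c1 in t2.
Qed.

Lemma pebble_inv_bounded t f k c : pebble_inv t f k c -> (k < L) && (c < L).
Proof.
have hE (e : edge G) : E e < L by apply: leq_trans hmL; rewrite hm /ednum.
by case=> *; rewrite ?hE ?andbT; lia.
Qed.

Lemma N_bounded v : N v < L.
Proof. by apply: leq_trans hnL; rewrite hn /vnum. Qed.

Lemma bounded_mkstate t (k c : edge P -> nat) :
  (forall f, pebble_inv t f (k f) (c f)) ->
  bounded (mkstate (fun x => N (r x)) k c).
Proof.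
move=> h; rewrite /bounded size_mkstate eqxx /=.
apply: all_mkstate => [x|f|f]; first exact: N_bounded.
  by have /andP[] := pebble_inv_bounded (h f).
by have /andP[] := pebble_inv_bounded (h f).
Qed.

Lemma reachable_model t : exists2 s, reachable t s & tracks t s.
Proof.
elim: t => [|t [s hreach hT]].
  have hI f : pebble_inv 0 f 0 0 by apply: Waiting.
  exists (mkstate (fun x => N (r x)) (fun=> 0) (fun=> 0)); last first.
    by split=> [x|f]; rewrite ?root_of_mkstate ?stage_mkstate ?place_mkstate.
  split; first exact: (bounded_mkstate hI).
  have [ss sm] := root_source hM; have [ts tm] := root_sink hM.
  have rs : r (source P) = source G.
    by have [a b] := hr (source P); apply: (root_uniq hM); rewrite ?b.
  have rt : r (sink P) = sink G.
    by have [a b] := hr (sink P); apply: (root_uniq hM); rewrite ?b.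
  apply/and4P; split; rewrite ?root_of_mkstate ?rs ?rt ?hs0 ?ht0 //.
    by apply/forallP=> x; rewrite root_of_mkstate hn /vnum.
  by apply/forallP=> f; rewrite stage_mkstate place_mkstate.
have [kc hkc] := fin_all_exists (fun f => tracks_move f hT).
pose s' := mkstate (fun x => N (r x)) (fun f => (kc f).1) (fun f => (kc f).2).
have hT' : tracks t.+1 s'.
  split=> [x|f]; rewrite ?root_of_mkstate ?stage_mkstate ?place_mkstate //.
  by case: (hkc f).
have hmove f : move_ok t s s' f.
  by have [_ h] := hkc f; apply: h; rewrite ?stage_mkstate ?place_mkstate.
exists s' => //; split.
  by apply: (@bounded_mkstate t.+1) => f; case: (hkc f).
exists s => //; apply/and3P; split.
- by apply/forallP=> x; rewrite root_of_mkstate (hT.1 x).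
- exact/forallP.
- apply/forallP=> f; apply/forallP=> g; apply/implyP=> hfg.
  exact: tracks_meet.
Qed.

End RunOfModel.

Lemma model_accepted : has_model P G -> accepted.
Proof.
move=> [tag [mu [kap hM]]].
have [r hr] := fin_all_exists (root_ex hM).
have [o ho] := fin_all_exists (own_ex hM).
have [s hreach [_ hI]] := reachable_model hM hr ho L.
(* At time [L] an unfinished pebble would be waiting for a vertex of level at least [L]. *)
exists s => //; apply/forallP=> f; have := hlvL; have := hI f.
by case=> [h|e _ h *|_ h|e _ h *|] //; rewrite leqNgt hlvL in h.
Qed.

(** * From an accepting run to a model *)

Section ModelOfRun.
Variable z : nat -> seq nat.
Hypothesis hinit : init_ok (z 0).
Hypothesis hstep : forall i, i < L -> step_ok i (z i) (z i.+1).
Hypothesis hfinal : final_ok (z L).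

Let k t f := stage f (z t).
Let c t f := place f (z t).

Lemma roots_of_run : exists r : vert P -> vert G,
  [/\ forall x t, t <= L -> root_of x (z t) = N (r x),
      r (source P) = source G & r (sink P) = sink G].
Proof.
have /and4P[/forallP h1 /eqP h2 /eqP h3 _] := hinit.
have hex x : exists v, root_of x (z 0) = N v by apply: N_onto; exact: h1.
have [r hr] := fin_all_exists hex.
exists r; split.
- move=> x; elim=> [|t IH] ht; first exact: hr.
  have /and3P[/forallP h _ _] := hstep ht.
  by rewrite (eqP (h x)); exact: IH (ltnW ht).
- by apply: N_inj; rewrite -hr h2 hs0.
- by apply: N_inj; rewrite -hr h3 ht0.
Qed.

Variable r : vert P -> vert G.
Hypothesis hr : forall x t, t <= L -> root_of x (z t) = N (r x).
Hypothesis hr_source : r (source P) = source G.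
Hypothesis hr_sink : r (sink P) = sink G.

(* The pebble [f] is about to pass through [v] when level [lvl v] is processed. *)
Definition passes f v : bool :=
  visits (lvl v) f (z (lvl v)) && (target f (z (lvl v)) == N v).

(** Read off just after the level of the tail, when the pebble enters [e]; [travels_persist] extends
    it up to the level of the head. *)
Definition travels f j (e : edge G) : bool :=
  [&& passes f (esrc e), k (lvl (esrc e)).+1 f == j
    & c (lvl (esrc e)).+1 f == E e].

Lemma run_move f t : t < L -> move_ok t (z t) (z t.+1) f.
Proof. by move=> /hstep/and3P[_ /forallP]. Qed.

Lemma run_meet f g t : t < L -> f != g -> meet_ok t (z t) (z t.+1) f g.
Proof.
by move=> /hstep/and3P[_ _ /forallP/(_ f)/forallP/(_ g)/implyP].
Qed.

Lemma stay f t : t < L -> ~~ visits t f (z t) ->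
  k t.+1 f = k t f /\ c t.+1 f = c t f.
Proof.
move=> /(run_move f)/and3P[_ _ /implyP h] /h.
by case/andP=> /eqP h1 /eqP h2.
Qed.

Lemma depart f t : t < L -> visits t f (z t) ->
  [\/ [/\ k t f < 2, k t.+1 f = 1 \/ k t.+1 f = 2, c t.+1 f < m &
          src (c t.+1 f) = target f (z t)],
      [/\ 1 < k t f, k t.+1 f = 3, c t.+1 f < m & src (c t.+1 f) = target f (z t)]
    | [/\ 1 < k t f, k t.+1 f = 4 & target f (z t) = N (r (etgt f))]].
Proof.
move=> ht hv; have /and3P[/implyP h1 /implyP h2 _] := run_move f ht.
have [h|h] := ltnP (stage f (z t)) 2.
  move: h1; rewrite hv h => /(_ isT)/and3P[h3 h4 /eqP h5].
  by constructor 1; split=> //; case/orP: h3 => /eqP; auto.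
move: h2; rewrite hv h => /(_ isT)/orP[|] /and3P[/eqP h3 h4 /eqP h5].
  by constructor 2.
by constructor 3; split=> //; rewrite h5 hr // ltnW.
Qed.

Lemma stage_mono f t u : t <= u <= L -> k t f <= k u f.
Proof.
case/andP; elim: u => [|u IH]; first by rewrite leqn0 => /eqP->.
rewrite leq_eqVlt => /orP[/eqP->//|htu hu].
apply: leq_trans (IH htu (ltnW hu)) _.
have [hv|/(stay hu)[-> _]//] := boolP (visits u f (z u)).
have h4 : k u f < 4 by case/andP: hv.
case: (depart hu hv) => -[h1 h2 _]; last by rewrite h2 ltnW.
  by case: h2 => -> _; lia.
by rewrite h2.
Qed.

(** The counterpart of [pebble_inv] when no model is given yet: since the edge under a pebble
    straddles level [t], no pebble misses the level at which it has to move. *)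
Lemma trace f t : t <= L ->
  (k t f = 0 -> t <= lvl (r (esrc f))) /\
  (0 < k t f < 4 -> exists e : edge G,
     [/\ c t f = E e, lvl (esrc e) < t, t <= lvl (etgt e) & travels f (k t f) e]).
Proof.
elim: t => [|t IH] ht.
  have /and4P[_ _ _ /forallP/(_ f)/andP[/eqP h1 _]] := hinit.
  by split=> //; rewrite /k h1.
have [IH1 IH2] := IH (ltnW ht).
have [hv|hv] := boolP (visits t f (z t)); last first.
  have [h1 h2] := stay ht hv; rewrite h1 h2; split.
    move=> hk; have := IH1 hk; rewrite leq_eqVlt => /orP[/eqP he|//].
    case/negP: hv; rewrite /visits /target -/(k t f) hk /= hr ?(ltnW ht) //.
    by rewrite he.
  move=> hk; have [e [e1 e2 e3 e4]] := IH2 hk.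
  exists e; split=> //; first exact: ltnW.
  rewrite ltn_neqAle e3 andbT; apply/eqP=> he; case/negP: hv.
  case/andP: (hk) => hk0 hk4; rewrite /visits /target -/(k t f) hk4 -/(c t f) e1.
  by rewrite -lt0n hk0 htgt he /=.
have enter : 0 < k t.+1 f -> c t.+1 f < m -> src (c t.+1 f) = target f (z t) ->
    exists e : edge G, [/\ c t.+1 f = E e, lvl (esrc e) < t.+1, t.+1 <= lvl (etgt e)
      & travels f (k t.+1 f) e].
  move=> h0 /E_onto[e he]; rewrite he hsrc => hh; exists e.
  have hle : lvl (esrc e) = t.
    by case/andP: hv => _ /eqP; rewrite -hh.
  split=> //; first by rewrite hle.
    by rewrite -hle; exact: hlv.
  by rewrite /travels /passes !hle hv -hh he !eqxx.
case: (depart ht hv) => -[h1 h2 h3].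
- by move=> h4; split; [case: h2 => ->|move=> /andP[h5 _]; exact: enter].
- by move=> h4; split; [rewrite h2|move=> /andP[h5 _]; exact: enter].
- by rewrite h2.
Qed.

Lemma travels_persist f j e t : 0 < j < 4 -> travels f j e ->
  lvl (esrc e) < t <= lvl (etgt e) -> k t f = j /\ c t f = E e.
Proof.
move=> /andP[hj0 hj4] /and3P[_ /eqP h1 /eqP h2] /andP[].
elim: t => // t IH; rewrite ltnS leq_eqVlt => /orP[/eqP<- //|h3 h4].
have [h5 h6] := IH h3 (ltnW h4).
have htL : t < L by apply: ltn_trans h4 _; exact: hlvL.
have [|-> ->//] := @stay f t htL.
rewrite /visits /target -/(k t f) h5 hj4 -lt0n hj0 -/(c t f) h6 htgt /=.
by rewrite gtn_eqF.
Qed.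

Lemma travels_src f j e : travels f j e ->
  [/\ passes f (esrc e), k (lvl (esrc e)).+1 f = j & c (lvl (esrc e)).+1 f = E e].
Proof. by case/and3P=> ? /eqP ? /eqP. Qed.

Lemma travels_tgt f j e : 0 < j < 4 -> travels f j e ->
  [/\ passes f (etgt e), k (lvl (etgt e)) f = j & c (lvl (etgt e)) f = E e].
Proof.
move=> hj hu; have [|h1 h2] := @travels_persist f j e (lvl (etgt e)) hj hu.
  by rewrite leqnn andbT; exact: hlv.
split=> //; case/andP: hj => hj0 hj4.
by rewrite /passes /visits /target -/(k _ f) h1 -/(c _ f) h2 hj4 -lt0n hj0 htgt !eqxx.
Qed.

Lemma passes_lt f v : passes f v -> k (lvl v) f < 4.
Proof. by case/andP=> /andP[]. Qed.

Lemma passes_in f v : passes f v ->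
  if k (lvl v) f == 0 then v = r (esrc f)
  else exists e, [/\ etgt e = v, travels f (k (lvl v) f) e & c (lvl v) f = E e].
Proof.
move=> hp; have /andP[/andP[h4 _] /eqP hh] := hp.
have hvL : lvl v <= L by rewrite ltnW // hlvL.
case: eqP => h0.
  move: hh; rewrite /target -/(k _ f) h0 /= hr // => /N_inj ->; done.
have [_ [|e [e1 _ _ e2]]] := trace f hvL.
  by rewrite lt0n; apply/andP; split=> //; apply/eqP.
exists e; split=> //; apply: N_inj; rewrite -htgt -e1 -hh /target -/(k _ f).
by move/eqP: h0 => ->.
Qed.

Lemma passes_out f v : passes f v ->
  [\/ [/\ k (lvl v) f < 2, k (lvl v).+1 f = 1 \/ k (lvl v).+1 f = 2 &
          exists e, [/\ esrc e = v, travels f (k (lvl v).+1 f) e &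
                        c (lvl v).+1 f = E e]],
      [/\ 1 < k (lvl v) f, k (lvl v).+1 f = 3 &
          exists e, [/\ esrc e = v, travels f 3 e & c (lvl v).+1 f = E e]]
    | [/\ 1 < k (lvl v) f, k (lvl v).+1 f = 4 & v = r (etgt f)]].
Proof.
move=> hp; have /andP[hv /eqP hh] := hp.
have edge : c (lvl v).+1 f < m -> src (c (lvl v).+1 f) = target f (z (lvl v)) ->
    exists e, [/\ esrc e = v, travels f (k (lvl v).+1 f) e & c (lvl v).+1 f = E e].
  move=> /E_onto[e he]; rewrite he hsrc hh => /N_inj hev.
  by exists e; split=> //; rewrite /travels hev hp he !eqxx.
case: (depart (hlvL v) hv) => -[h1 h2 h3].
- by move=> h4; constructor 1; split=> //; exact: edge.
- by move=> h4; constructor 2; split=> //; rewrite -{1}h2; exact: edge.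
- by constructor 3; split=> //; apply: N_inj; rewrite -hh.
Qed.

Lemma passes_meet f g v : f != g -> passes f v -> passes g v ->
  [/\ k (lvl v) f < 2 -> k (lvl v) g < 2 ->
        [/\ esrc f = esrc g, k (lvl v) f = k (lvl v) g, c (lvl v) f = c (lvl v) g &
            ~ [/\ k (lvl v).+1 f = 2, k (lvl v).+1 g = 2 &
                  c (lvl v).+1 f = c (lvl v).+1 g]],
      1 < k (lvl v) f -> 1 < k (lvl v) g ->
        [/\ etgt f = etgt g, k (lvl v).+1 f = k (lvl v).+1 g &
            c (lvl v).+1 f = c (lvl v).+1 g]
    & 1 < k (lvl v) f -> k (lvl v) g < 2 ->
        [/\ k (lvl v).+1 f = 4, k (lvl v) g = 0 & etgt f = esrc g]].
Proof.
move=> hfg /andP[v1 /eqP h1] /andP[v2 /eqP h2].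
have := run_meet (hlvL v) hfg; rewrite /meet_ok v1 v2 h1 h2 eqxx /=.
rewrite -!/(k _ _) -!/(c _ _) => /and3P[m1 m2 m3]; split=> e1 e2.
- move: m1; rewrite e1 e2 => /and4P[/eqP a1 /eqP a2 /eqP a3 a4].
  by split=> // -[b1 b2 b3]; rewrite b1 b2 b3 !eqxx in a4.
- by move: m2; rewrite e1 e2 => /and3P[/eqP a1 /eqP a2 /eqP a3].
- by move: m3; rewrite e1 e2 => /and3P[/eqP a1 /eqP a2 /eqP a3].
Qed.

Lemma starts f : passes f (r (esrc f)) /\ k (lvl (r (esrc f))) f = 0.
Proof.
have hk t : t <= lvl (r (esrc f)) -> k t f = 0.
  elim: t => [|t IH] ht.
    by have /and4P[_ _ _ /forallP/(_ f)/andP[/eqP h1 _]] := hinit.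
  have htL : t < L by apply: ltn_trans ht _; exact: hlvL.
  have [|-> _] := @stay f t htL; last exact: IH (ltnW ht).
  rewrite /visits /target -/(k t f) (IH (ltnW ht)) /= hr 1?ltnW //.
  by rewrite gtn_eqF.
have h0 := hk _ (leqnn _); split=> //.
have hvL : lvl (r (esrc f)) <= L by rewrite ltnW // hlvL.
by rewrite /passes /visits /target -!/(k _ f) h0 /= hr // !eqxx.
Qed.

(** Stages run from 0 to 4. Crossing 4 shows where a pebble ends; crossing 2 yields its representing
    edge, since a stage below 2 is followed by at most 2. *)
Lemma crossing f j : 0 < j <= 4 -> exists2 t, t < L & k t f < j <= k t.+1 f.
Proof.
move=> /andP[hj0 hj4].
have hk0 : k 0 f = 0.
  by have /and4P[_ _ _ /forallP/(_ f)/andP[/eqP h1 _]] := hinit.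
have hkL : j <= k L f.
  by have /forallP/(_ f)/eqP := hfinal; rewrite /k => ->.
have hex : exists t, j <= k t f by exists L.
case: (ex_minnP hex) => -[|t] ht hmin; first by rewrite hk0 leqNgt hj0 in ht.
exists t; first exact: hmin hkL.
rewrite ht andbT ltnNge; apply/negP=> h; by have := hmin _ h; rewrite ltnn.
Qed.

Lemma moves f t : t < L -> k t f < k t.+1 f -> visits t f (z t).
Proof.
move=> ht hlt; apply: contraLR hlt => /(stay ht)[-> _].
by rewrite ltnn.
Qed.

Lemma finishes f : exists v,
  [/\ passes f v, 1 < k (lvl v) f, k (lvl v).+1 f = 4 & v = r (etgt f)].
Proof.
have [t ht /andP[h1 h2]] := crossing f (erefl : 0 < 4 <= 4).
have hv := moves ht (leq_trans h1 h2).
case: (depart ht hv) => -[e1 e2 e3].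
- by case: e2 h2 => ->.
- by rewrite e2 in h2.
exists (r (etgt f)).
have hl : lvl (r (etgt f)) = t by case/andP: hv => _ /eqP; rewrite e3.
by rewrite /passes hl hv e3 eqxx.
Qed.

Lemma owns f : exists e, travels f 2 e.
Proof.
have [t ht /andP[h1 h2]] := crossing f (erefl : 0 < 2 <= 4).
have hv := moves ht (leq_trans h1 h2).
case: (depart ht hv) => -[e1 e2 e3]; try by rewrite ltnNge e1 in h1.
have hk : k t.+1 f = 2 by case: e2 h2 => ->.
by have [_] := trace f ht; rewrite hk => /(_ isT)[e [_ _ _ he]]; exists e.
Qed.

Definition label f v : role * vert P :=
  if k (lvl v) f == 0 then (Root, esrc f)
  else if k (lvl v) f == 1 then (Out, esrc f)
  else if k (lvl v).+1 f == 4 then (Root, etgt f) else (In, etgt f).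

(** The clauses of [meet_ok] cover two early, two late and two different pebbles; in the last case
    both labels are the root at which one ends and the other starts. *)
Lemma label_eq f g v : passes f v -> passes g v -> label f v = label g v.
Proof.
have [->//|hfg] := eqVneq f g; move=> pf pg.
have [m1 m2 m3] := passes_meet hfg pf pg.
have hgf : g != f by rewrite eq_sym.
have [_ _ m4] := passes_meet hgf pg pf.
have [h1|h1] := ltnP (k (lvl v) f) 2; have [h2|h2] := ltnP (k (lvl v) g) 2.
- by have [e1 e2 _ _] := m1 h1 h2; rewrite /label e1 e2; case: (k _ g) h1 h2 e2 => [|[|]].
- have [e1 e2 e3] := m4 h2 h1; rewrite /label e1 e2 e3 eqxx /=.
  by case: (k _ g) h2 => [|[|]].
- have [e1 e2 e3] := m3 h1 h2; rewrite /label e1 e2 e3 eqxx /=.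
  by case: (k _ f) h1 => [|[|]].
- have [e1 e2 e3] := m2 h1 h2; rewrite /label e1 e2.
  by case: (k _ f) h1 => [|[|]] // ? _; case: (k _ g) h2 => [|[|]].
Qed.

Definition run_label v : role * vert P :=
  if [pick f | passes f v] is Some f then label f v else (Free, source P).

Lemma run_labelE f v : passes f v -> run_label v = label f v.
Proof.
move=> pf; rewrite /run_label; case: pickP => [g pg|/(_ f)]; last by rewrite pf.
exact: label_eq.
Qed.

Lemma run_label_free v : (run_label v).1 <> Free -> exists f, passes f v.
Proof. by rewrite /run_label; case: pickP => // f pf _; exists f. Qed.

Lemma label_in f v : (label f v).1 = In -> 1 < k (lvl v) f.
Proof. by rewrite /label; case: (k (lvl v) f) => [|[|]]. Qed.

Lemma label_out f v : (label f v).1 = Out -> k (lvl v) f = 1.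
Proof. by rewrite /label; case: (k (lvl v) f) => [|[|]] // ? /=; case: eqP. Qed.

Lemma label_early f v : k (lvl v) f < 2 ->
  outward (label f v).1 /\ (label f v).2 = esrc f.
Proof. by rewrite /label; case: (k (lvl v) f) => [|[|]]. Qed.

Lemma label_late f v : 1 < k (lvl v) f ->
  inward (label f v).1 /\ (label f v).2 = etgt f.
Proof. by rewrite /label; case: (k (lvl v) f) => [|[|]] // ? _ /=; case: eqP. Qed.

Lemma passes_early f v : passes f v -> 0 < k (lvl v).+1 f < 3 -> k (lvl v) f < 2.
Proof.
by case/passes_out=> -[h1 h2 _] //; rewrite h2.
Qed.

Lemma passes_late f v : passes f v -> 2 < k (lvl v).+1 f -> 1 < k (lvl v) f.
Proof. by case/passes_out=> -[h1 h2 _] //; case: h2 => ->. Qed.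

(** For distinct pebbles, three cases are excluded. If [g] is late at the tail, it must end there
    instead of entering [e]. If it enters [e] in stage 2, the pebbles share a representing edge. If
    it enters in stage 1, it meets the late [f] at the head, where it would have to be waiting. *)
Lemma own_alone f g j e : travels f 2 e -> travels g j e -> 0 < j < 4 -> f = g.
Proof.
move=> hf hg hj; apply/eqP; apply: contraT => hfg.
have [pf kf cf] := travels_src hf; have [pg kg cg] := travels_src hg.
have [pf' kf' cf'] := travels_tgt (isT : 0 < 2 < 4) hf.
have [pg' kg' cg'] := travels_tgt hj hg.
have ef : k (lvl (esrc e)) f < 2 by apply: passes_early => //; rewrite kf.
have [m1 _ _] := passes_meet hfg pf pg.
have [_ _ m3] := passes_meet hfg pf' pg'.
have hgf : g != f by rewrite eq_sym.
have [_ _ m4] := passes_meet hgf pg pf.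
have [h|h] := ltnP (k (lvl (esrc e)) g) 2.
  have [_ _ _ hne] := m1 ef h.
  case: (passes_out pg) => -[a1 a2 _]; last 2 first.
  - by rewrite ltnNge a1 in h.
  - by rewrite ltnNge a1 in h.
  case: a2 => a2; last by case: hne; rewrite kf cf cg a2.
  have [||_] := m3; rewrite ?kf' ?kg' -?kg ?a2 //.
have [a1 _ _] := m4 h ef.
by move: hj; rewrite -kg a1.
Qed.

Definition run_kap e : option (option (edge P)) :=
  if [pick f | travels f 2 e] is Some f then Some (Some f)
  else if [exists f, travels f 1 e || travels f 3 e] then Some None else None.

Lemma run_kap_own e f : run_kap e = Some (Some f) -> travels f 2 e.
Proof.
by rewrite /run_kap; case: pickP => [g hg [<-]//|_]; case: ifP.
Qed.

Lemma run_kap_ownE e f : travels f 2 e -> run_kap e = Some (Some f).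
Proof.
rewrite /run_kap; case: pickP => [g hg hf|/(_ f)->//].
by rewrite (own_alone hf hg).
Qed.

Lemma run_kap_tree e : run_kap e = Some None ->
  exists f, travels f 1 e \/ travels f 3 e.
Proof.
rewrite /run_kap; case: pickP => // _; case: ifP => // /existsP[f /orP h] _.
by exists f.
Qed.

Lemma run_kap_used e : run_kap e <> None ->
  exists f j, (0 < j < 4) /\ travels f j e.
Proof.
case hk: (run_kap e) => [[f|]|] // _.
  by exists f, 2; split=> //; exact: run_kap_own.
by have [f [h|h]] := run_kap_tree hk; [exists f, 1|exists f, 3].
Qed.

Lemma travels_used e f j : 0 < j < 4 -> travels f j e -> run_kap e <> None.
Proof.
move=> hj hf; rewrite /run_kap; case: pickP => // h2.
suff -> : [exists f, travels f 1 e || travels f 3 e] by [].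
apply/existsP; exists f; move: j hj hf (h2 f) => [|[|[|[|]]]] // _ -> //.
by rewrite orbT.
Qed.

Lemma run_model : model (fun v => (run_label v).1) (fun v => (run_label v).2) run_kap.
Proof.
have [_ hPi hPo] := hP.
split.
- move=> e f /run_kap_own hf; have [pf kf cf] := travels_src hf.
  by rewrite (run_labelE pf); apply: label_early; apply: passes_early => //; rewrite kf.
- move=> e f /run_kap_own hf; have [pf kf cf] := travels_tgt (isT : 0 < 2 < 4) hf.
  by rewrite (run_labelE pf); apply: label_late; rewrite kf.
- by move=> f; have [e he] := owns f; exists e; exact: run_kap_ownE.
(* Stage 2 is entered only from a stage below 2 and stages never decrease, so it is entered once. *)
- have key e e1 f : travels f 2 e -> travels f 2 e1 -> lvl (esrc e) < lvl (esrc e1) -> False.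
    move=> /travels_src[pf kf cf] /travels_src[pf1 kf1 cf1] hlt.
    have := @stage_mono f (lvl (esrc e)).+1 (lvl (esrc e1)).
    rewrite hlt (ltnW (hlvL _)) kf leqNgt (passes_early pf1) ?kf1 //.
    by move/(_ isT).
  move=> e e1 f /run_kap_own hf /run_kap_own hf1.
  have [h|h|h] := ltngtP (lvl (esrc e)) (lvl (esrc e1)).
  + by case: (key _ _ _ hf hf1 h).
  + by case: (key _ _ _ hf1 hf h).
  have [_ _ cf] := travels_src hf; have [_ _ cf1] := travels_src hf1.
  by apply: E_inj; rewrite -cf -cf1 h.
- move=> e /run_kap_tree[f [] hf]; have [pf kf cf] := travels_src hf.
    have [pf' kf' cf'] := travels_tgt (isT : 0 < 1 < 4) hf.
    have [|h1 h2] := @label_early f (esrc e); first by apply: passes_early; rewrite ?kf.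
    have h3 : label f (etgt e) = (Out, esrc f) by rewrite /label kf'.
    rewrite (run_labelE pf) (run_labelE pf') h2 h3; split=> //.
    by right.
  have [pf' kf' cf'] := travels_tgt (isT : 0 < 3 < 4) hf.
  have h1 : 1 < k (lvl (esrc e)) f by apply: passes_late; rewrite ?kf.
  have [|h2 h3] := @label_late f (etgt e); first by rewrite kf'.
  rewrite (run_labelE pf) (run_labelE pf') h3; split; first by case: (label_late h1).
  left; split=> //; rewrite /label kf.
  by case: (k _ f) h1 => [|[|]].
- move=> e e1 /run_kap_used[f [j [hj hf]]] /run_kap_used[g [i [hi hg]]] hs ht.
  have [pf kf cf] := travels_src hf; have [pg kg cg] := travels_src hg.
  rewrite hs in pg kg cg.
  apply: E_inj; rewrite -cf -cg; have [->//|hfg] := eqVneq f g.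
  have h1 : 1 < k (lvl (esrc e)) f by apply: label_in; rewrite -(run_labelE pf).
  have h2 : 1 < k (lvl (esrc e)) g by apply: label_in; rewrite -(run_labelE pg).
  by have [_ /(_ h1 h2)[_ _ ->]] := passes_meet hfg pf pg.
- move=> e e1 /run_kap_used[f [j [hj hf]]] /run_kap_used[g [i [hi hg]]] hs ht.
  have [pf kf cf] := travels_tgt hj hf; have [pg kg cg] := travels_tgt hi hg.
  rewrite hs in pg kg cg.
  apply: E_inj; rewrite -cf -cg; have [->//|hfg] := eqVneq f g.
  have h1 : k (lvl (etgt e)) f = 1 by apply: label_out; rewrite -(run_labelE pf).
  have h2 : k (lvl (etgt e)) g = 1 by apply: label_out; rewrite -(run_labelE pg).
  by have [m1 _ _] := passes_meet hfg pf pg; have [||_ _ ->] := m1; rewrite ?h1 ?h2.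
- have start g : exists2 e, run_kap e <> None & esrc e = r (esrc g).
    have [pg kg] := starts g.
    case: (passes_out pg) => -[a1 a2]; rewrite ?kg // in a1 *.
    case=> e [he hu _]; exists e => //; apply: travels_used hu.
    by case: a2 => ->.
  move=> v /run_label_free[f pf] hv.
  case: (passes_out pf) => -[h1 h2].
  + case=> e [he hu _]; exists e => //; apply: travels_used hu.
    by case: h2 => ->.
  + by case=> e [he hu _]; exists e => //; exact: travels_used hu.
  (* Here [f] ends at a root other than the sink; an edge of [P] leaves the corresponding vertex,
     and its pebble starts at [v]. *)
  + move=> h3; have [|g hg] := hPo (etgt f).
      by apply: contraNneq hv => h; rewrite h3 h hr_sink.
    by rewrite h3 -hg; exact: start.
- have finish g : exists2 e, run_kap e <> None & etgt e = r (etgt g).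
    have [v [pg h1 _ <-]] := finishes g.
    have := passes_in pg; case: eqP => [h|_ [e [he hu _]]]; first by rewrite h in h1.
    by exists e => //; apply: travels_used hu; rewrite (passes_lt pg) ltnW.
  move=> v /run_label_free[f pf] hv.
  have := passes_in pf; case: eqP => [h0 hvr|h0 [e [he hu _]]].
    have [|g hg] := hPi (esrc f).
      by apply: contraNneq hv => h; rewrite hvr h hr_source.
    by rewrite hvr -hg; exact: finish.
  by exists e => //; apply: travels_used hu; rewrite (passes_lt pf) lt0n; move/eqP: h0 => ->.
(* The root is witnessed by a pebble that starts there, or, for the sink, by one that ends there. *)
- move=> x; have [hx|hx] := eqVneq x (sink P).
    have [|g hg] := hPi x; first by rewrite hx eq_sym.
    have [v [pg h1 h2 hv]] := finishes g; exists v.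
    rewrite (run_labelE pg) /label h2 eqxx hg.
    by case: (k _ g) h1 => [|[|]].
  have [g hg] := hPo x hx; have [pg kg] := starts g; exists (r (esrc g)).
  by rewrite (run_labelE pg) /label kg eqxx hg.
- have hroot v : (run_label v).1 = Root -> v = r (run_label v).2.
    move=> hv; have [|f pf] := @run_label_free v; first by rewrite hv.
    move: hv; rewrite (run_labelE pf) /label.
    case: eqP => [h0 _|h0]; first by have := passes_in pf; rewrite h0.
    case: eqP => // h1; case: eqP => // h4 _.
    by case: (passes_out pf) => -[a1 a2] //; rewrite h4 // in a2 *; case: a2.
  by move=> v w /hroot h1 /hroot h2 h; rewrite h1 h -h2.
- have [g hg] := hPo (source P) hPst; have [pg kg] := starts g.
  by rewrite -hr_source -hg (run_labelE pg) /label kg eqxx hg.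
- have [|g hg] := hPi (sink P); first by rewrite eq_sym.
  have [v [pg h1 h2 hv]] := finishes g.
  rewrite -hr_sink -hg -hv (run_labelE pg) /label h2 eqxx.
  by case: (k _ g) h1 => [|[|]].
Qed.

End ModelOfRun.

Lemma accepted_model : accepted -> has_model P G.
Proof.
move=> [s /reachable_run[z [hz h0 hs]] hf].
have [r [h1 h2 h3]] := roots_of_run h0 hs.
by do 3!eexists; apply: (run_model h0 hs _ h1 h2 h3); rewrite hz.
Qed.

Lemma accepted_modelP : accepted <-> has_model P G.
Proof. by split; [exact: accepted_model|exact: model_accepted]. Qed.

End Game.

(** * Deciding the game *)

Section Loops.
Variable L : nat.
Implicit Types (env x y : seq nat) (m : nat -> nat) (p : prog).

Lemma den_For_ind p env m (I : nat -> (nat -> nat) -> Prop) :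
  (forall i m, i < L -> I i m -> I i.+1 (den L p (rcons env i) m)) ->
  I 0 m -> I L (den L (For p) env m).
Proof.
move=> hstep h0 /=.
suff h k j m1 : k + j = L -> I j m1 ->
    I L (foldl (fun m i => den L p (rcons env i) m) m1 (iota j k)).
  by apply: h h0; rewrite addn0.
elim: k j m1 => [|k IH] j m1 /=; first by rewrite add0n => ->.
by move=> hk hI; apply: IH; [lia|apply: hstep => //; lia].
Qed.

Definition box k x : bool := (size x == k) && all (fun i => i < L) x.

Lemma den_Fors_inv k p env m (I : (nat -> nat) -> Prop) :
  (forall x m, box k x -> I m -> I (den L p (env ++ x) m)) ->
  I m -> I (den L (iter k For p) env m).
Proof.
elim: k env m => [|k IH] env m h h0; first by have := h [::] m erefl h0; rewrite cats0.
apply: (@den_For_ind _ _ _ (fun _ => I)) h0 => i m1 hi h1.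
apply: IH h1 => x m2 hx h2; rewrite cat_rcons; apply: h => //.
by case/andP: hx => h3 h4; rewrite /box /= eqSS h3 hi.
Qed.

(** Used for table entries: [J] says that an entry is set, which happens when the loops reach [x0]
    and is never undone, while [I] holds throughout. *)
Lemma den_Fors_hit k p env m x0 (I J : (nat -> nat) -> Prop) :
  box k x0 ->
  (forall x m, box k x -> I m -> I (den L p (env ++ x) m)) ->
  (forall x m, box k x -> I m -> J m -> J (den L p (env ++ x) m)) ->
  (forall m, I m -> J (den L p (env ++ x0) m)) ->
  I m -> J (den L (iter k For p) env m).
Proof.
elim: k x0 env m => [|k IH] x0 env m hx0 hI hJ hit h0.
  by move: hx0 hit; case: x0 => // _ /(_ m h0); rewrite cats0.
case: x0 hx0 hit => // i0 x0 /andP[hs /= /andP[hi0 hx0]] hit.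
have hbox i x : i < L -> box k x -> box k.+1 (i :: x).
  by move=> hi /andP[h1 h2]; rewrite /box /= eqSS h1 hi.
have hIi i m1 : i < L -> I m1 -> I (den L (iter k For p) (rcons env i) m1).
  move=> hi; apply: den_Fors_inv => x m2 hx h2.
  by rewrite cat_rcons; apply: hI => //; exact: hbox.
suff [_ h] : I (den L (iter k.+1 For p) env m) /\
    (i0 < L -> J (den L (iter k.+1 For p) env m)) by exact: h.
apply: (@den_For_ind _ _ _ (fun i m => I m /\ (i0 < i -> J m))) => // i m1 hi [h1 h2].
split; first exact: hIi.
rewrite ltnS leq_eqVlt => /orP[/eqP<-|/h2 h3].
  apply: (IH x0 (rcons env i0)) => //.
  - by rewrite /box hx0 -eqSS hs.
  - by move=> x m2 hx; rewrite cat_rcons; apply: hI; exact: hbox.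
  - by move=> x m2 hx; rewrite cat_rcons; apply: hJ; exact: hbox.
  - by move=> m2; rewrite cat_rcons; exact: hit.
suff [] : I (den L (iter k For p) (rcons env i) m1) /\
    J (den L (iter k For p) (rcons env i) m1) by [].
apply: (@den_Fors_inv _ _ _ _ (fun m => I m /\ J m)) => // x m2 hx [h4 h5].
by rewrite cat_rcons; split; [apply: hI|apply: hJ] => //; exact: hbox.
Qed.

Lemma den_For_hit p env m i0 (I J : (nat -> nat) -> Prop) :
  i0 < L ->
  (forall i m, i < L -> I m -> I (den L p (rcons env i) m)) ->
  (forall i m, i < L -> I m -> J m -> J (den L p (rcons env i) m)) ->
  (forall m, I m -> J (den L p (rcons env i0) m)) ->
  I m -> J (den L (For p) env m).
Proof.
move=> hi0 hI hJ hit; apply: (@den_Fors_hit 1 p env m [:: i0]).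
- by rewrite /box /= hi0.
- by move=> [|i [|]] // m1 /andP[_ /= /andP[hi _]]; rewrite cats1; exact: hI.
- by move=> [|i [|]] // m1 /andP[_ /= /andP[hi _]]; rewrite cats1; exact: hJ.
- by move=> m1; rewrite cats1; exact: hit.
Qed.

Definition code t x : nat := foldl (fun a i => a * L + i) t x.

Lemma code_inj t u k x y : box k x -> box k y -> code t x = code u y ->
  t = u /\ x = y.
Proof.
elim: k x y => [|k IH] x y; first by case: x => //; case: y.
case/lastP: x => [|x i]; first by rewrite /box.
case/lastP: y => [|y j]; first by rewrite /box.
rewrite /box !size_rcons !all_rcons !eqSS /code !foldl_rcons.
move=> /and3P[h1 h2 h3] /and3P[h4 h5 h6] heq.
have hij : i = j by have := congr1 (modn^~ L) heq; rewrite !modnMDl !modn_small.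
have hc : code t x = code u y.
  move: heq; rewrite hij => /addIn/eqP; rewrite eqn_pmul2r; last by lia.
  by move/eqP.
have [||-> ->] := IH x y _ _ hc; rewrite /box ?h1 ?h4 //.
by rewrite hij.
Qed.

End Loops.

Definition eNot (a : expr) : expr := Ite a (Cst 0) (Cst 1).
Definition eAnd (a b : expr) : expr := Ite a b (Cst 0).
Definition eOr (a b : expr) : expr := Ite a (Cst 1) b.
Definition eImp (a b : expr) : expr := Ite a b (Cst 1).
Definition eLt (a b : expr) : expr := Minus b a.
Definition eEq (a b : expr) : expr := eNot (Plus (Minus a b) (Minus b a)).
(** The quantifiers of the game range over the fixed pattern and are unfolded into the program
    text. *)
Definition eAll (T : finType) (F : T -> expr) : expr :=
  foldr (fun x => eAnd (F x)) (Cst 1) (enum T).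

Section Conditions.
Variables (L : nat) (env : seq nat) (mm : nat -> nat).

Definition holds (a : expr) : bool := eval L env mm a != 0.

Lemma holds_not a : holds (eNot a) = ~~ holds a.
Proof. by rewrite /holds /=; case: ifP. Qed.

Lemma holds_and a b : holds (eAnd a b) = holds a && holds b.
Proof. by rewrite /holds /=; case: ifP. Qed.

Lemma holds_or a b : holds (eOr a b) = holds a || holds b.
Proof. by rewrite /holds /=; case: ifP. Qed.

Lemma holds_imp a b : holds (eImp a b) = (holds a ==> holds b).
Proof. by rewrite /holds /=; case: ifP. Qed.

Lemma holds_lt a b : holds (eLt a b) = (eval L env mm a < eval L env mm b).
Proof. by rewrite /holds /= -lt0n subn_gt0. Qed.

Lemma holds_eq a b : holds (eEq a b) = (eval L env mm a == eval L env mm b).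
Proof. by rewrite holds_not /holds /= negbK addn_eq0 !subn_eq0 -eqn_leq. Qed.

Lemma holds_bool (b : bool) : holds (Cst b) = b.
Proof. by case: b. Qed.

Lemma holds_all (T : finType) (F : T -> expr) :
  holds (eAll F) = [forall x, holds (F x)].
Proof.
have -> : [forall x, holds (F x)] = all (fun x => holds (F x)) (enum T).
  apply/forallP/allP=> h x; first by move=> _; exact: h.
  by apply: h; rewrite mem_enum.
by rewrite /eAll; elim: (enum T) => //= x s IH; rewrite holds_and IH.
Qed.

Definition holdsE := (holds_not, holds_and, holds_or, holds_imp, holds_lt,
  holds_eq, holds_all, holds_bool).

End Conditions.

Section Program.
Variable P : mgraph.
Notation K := (state_size P).

Definition e_vertices := Peek (Cst 0).
Definition e_edges := Peek (Cst 1).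
(* Not every entry of the table describes a legal configuration: edge numbers out
   of range are sent to 0, so that the program never reads the table itself. *)
Definition e_src (a : expr) : expr :=
  Ite (eLt a e_edges) (Peek (Plus (Cst 4) (Plus a a))) (Cst 0).
Definition e_tgt (a : expr) : expr :=
  Ite (eLt a e_edges) (Peek (Plus (Cst 5) (Plus a a))) (Cst 0).
Definition e_level (a : expr) : expr := Ite (eLt a e_vertices) (Peek (Plus Len a)) (Cst 0).

(** A configuration is held by consecutive loop variables from number [o] on, so two of them are
    compared by giving two offsets. In the sweep, variable 0 is the time. *)
Definition e_root o (x : vert P) := Var (o + enum_rank x).
Definition e_stage o (f : edge P) := Var (o + (#|vert P| + enum_rank f)).
Definition e_place o (f : edge P) :=
  Var (o + (#|vert P| + (#|edge P| + enum_rank f))).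

Definition e_target o f :=
  Ite (e_stage o f) (e_tgt (e_place o f)) (e_root o (esrc f)).

Definition e_visits o f :=
  eAnd (eLt (e_stage o f) (Cst 4)) (eEq (e_level (e_target o f)) (Var 0)).

Definition e_init :=
  eAnd (eAll (fun x => eLt (e_root 0 x) e_vertices))
    (eAnd (eEq (e_root 0 (source P)) (Peek (Cst 2)))
      (eAnd (eEq (e_root 0 (sink P)) (Peek (Cst 3)))
        (eAll (fun f => eAnd (eEq (e_stage 0 f) (Cst 0)) (eEq (e_place 0 f) (Cst 0)))))).

Definition e_final := eAll (fun f => eEq (e_stage 0 f) (Cst 4)).

Definition e_early o f := eLt (e_stage o f) (Cst 2).
Definition e_late o f := eLt (Cst 1) (e_stage o f).

Definition e_move o o' f :=
  eAnd (eImp (eAnd (e_visits o f) (e_early o f))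
         (eAnd (eOr (eEq (e_stage o' f) (Cst 1)) (eEq (e_stage o' f) (Cst 2)))
            (eAnd (eLt (e_place o' f) e_edges)
               (eEq (e_src (e_place o' f)) (e_target o f)))))
    (eAnd (eImp (eAnd (e_visits o f) (e_late o f))
            (eOr (eAnd (eEq (e_stage o' f) (Cst 3))
                    (eAnd (eLt (e_place o' f) e_edges)
                       (eEq (e_src (e_place o' f)) (e_target o f))))
               (eAnd (eEq (e_stage o' f) (Cst 4))
                  (eAnd (eEq (e_place o' f) (Cst 0))
                     (eEq (e_target o f) (e_root o (etgt f)))))))
       (eImp (eNot (e_visits o f))
          (eAnd (eEq (e_stage o' f) (e_stage o f))
             (eEq (e_place o' f) (e_place o f))))).

Definition e_meet o o' (f g : edge P) :=
  eImp (eAnd (e_visits o f) (eAnd (e_visits o g) (eEq (e_target o f) (e_target o g))))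
    (eAnd (eImp (eAnd (e_early o f) (e_early o g))
            (eAnd (Cst (esrc f == esrc g))
               (eAnd (eEq (e_stage o f) (e_stage o g))
                  (eAnd (eEq (e_place o f) (e_place o g))
                     (eNot (eAnd (eEq (e_stage o' f) (Cst 2))
                              (eAnd (eEq (e_stage o' g) (Cst 2))
                                 (eEq (e_place o' f) (e_place o' g)))))))))
       (eAnd (eImp (eAnd (e_late o f) (e_late o g))
               (eAnd (Cst (etgt f == etgt g))
                  (eAnd (eEq (e_stage o' f) (e_stage o' g))
                     (eEq (e_place o' f) (e_place o' g)))))
          (eImp (eAnd (e_late o f) (e_early o g))
             (eAnd (eEq (e_stage o' f) (Cst 4))
                (eAnd (eEq (e_stage o g) (Cst 0)) (Cst (etgt f == esrc g))))))).

Definition e_step o o' :=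
  eAnd (eAll (fun x => eEq (e_root o' x) (e_root o x)))
    (eAnd (eAll (fun f => e_move o o' f))
       (eAll (fun f => eAll (fun g => eImp (Cst (f != g)) (e_meet o o' f g))))).

(* The reachability table starts at address [2 * L]; the levels of the vertices
   are kept from address [L] on, followed by the cell for the answer. *)
Fixpoint e_code a o k :=
  if k is k.+1 then Plus (MulLen (e_code a o k)) (Var (o + k)) else a.

Definition e_entry a o := Plus (Plus Len Len) (e_code a o K).
Definition e_answer := Plus Len e_vertices.

(** Bellman-Ford relaxation for longest paths; with truncated subtraction, [a + (b - a)] is the
    maximum of [a] and [b]. *)
Definition relax_body : prog :=
  When (eLt (Var 1) e_edges)
    (Write (Plus Len (e_tgt (Var 1)))
       (Plus (Peek (Plus Len (e_tgt (Var 1))))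
          (Minus (Plus (Peek (Plus Len (e_src (Var 1)))) (Cst 1))
             (Peek (Plus Len (e_tgt (Var 1))))))).

Definition relax_prog : prog := For (For relax_body).

Definition init_prog : prog :=
  iter K For (When e_init (Write (e_entry (Cst 0) 0) (Cst 1))).

Definition sweep_prog : prog :=
  For (iter K For (iter K For
    (When (eAnd (Peek (e_entry (Var 0) 1)) (e_step 1 K.+1))
       (Write (e_entry (Plus (Var 0) (Cst 1)) K.+1) (Cst 1))))).

Definition answer_prog : prog :=
  iter K For (When (eAnd (Peek (e_entry Len 0)) e_final) (Write e_answer (Cst 1))).

Definition main_prog : prog :=
  Then relax_prog (Then init_prog (Then sweep_prog answer_prog)).

(** * Correctness of the program on a host graph *)

Section Run.
Variables (G : mgraph) (hP : dag P) (hPst : source P != sink P) (hG : dag G).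

Let w := encode G.
Let L := size w + 5.
Let n := #|vert G|.
Let m := #|edge G|.
Notation N := (@vnum G).
Notation E := (@ednum G).

Let gsrc i := if i < m then nth 0 w (4 + (i + i)) else 0.
Let gtgt i := if i < m then nth 0 w (5 + (i + i)) else 0.

Lemma sizeE : L = 9 + 2 * m.
Proof. by rewrite /L /w size_encode; lia. Qed.

Lemma nth_encode (e : edge G) :
  nth 0 w (4 + (E e + E e)) = N (esrc e) /\ nth 0 w (5 + (E e + E e)) = N (etgt e).
Proof.
have key s i : i < size s ->
    nth 0 (flatten [seq [:: N (esrc e1); N (etgt e1)] | e1 <- s]) (i + i) =
      N (esrc (nth e s i)) /\
    nth 0 (flatten [seq [:: N (esrc e1); N (etgt e1)] | e1 <- s]) (i + i).+1 =
      N (etgt (nth e s i)).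
  elim: s i => //= e1 s IH [|i] hi //=.
  by rewrite addnS /=; exact: IH.
have := key (enum (edge G)) (enum_rank e); rewrite nth_enum_rank -cardE ltn_ord.
exact.
Qed.

Lemma gsrcE e : gsrc (E e) = N (esrc e).
Proof. by rewrite /gsrc ltn_ord; case: (nth_encode e). Qed.

Lemma gtgtE e : gtgt (E e) = N (etgt e).
Proof. by rewrite /gtgt ltn_ord; case: (nth_encode e). Qed.

(** Counting the vertices of smaller rank turns any rank into one below [n]. It bounds the computed
    levels and the number of rounds that relaxation needs. *)
Lemma bounded_rank : exists d : vert G -> nat,
  (forall e, d (esrc e) < d (etgt e)) /\ forall v, d v < n.
Proof.
have [[d hd] _ _] := hG.
exists (fun v => #|[set u | d u < d v]|); split=> [e|v].
  apply: proper_card; apply/properP; split.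
    by apply/subsetP=> u; rewrite !inE => h; exact: ltn_trans h (hd e).
  by exists (esrc e); rewrite inE ?hd // ltnn.
rewrite /n -cardsT; apply: proper_card; rewrite properT; apply/eqP=> h.
by have := in_setT v; rewrite -h inE ltnn.
Qed.

(** Each vertex except the source is the head of an edge. The input length depends on [m] only, so
    this is needed for [L] to exceed [n]. *)
Lemma vertices_le : n <= m.+1.
Proof.
have [_ hi _] := hG.
have hsub : [set: vert G] \subset source G |: [set etgt e | e in [set: edge G]].
  apply/subsetP=> v _; rewrite !inE; have [//|/hi[e <-]] := eqVneq v (source G).
  by rewrite imset_f ?inE.
have := subset_leq_card hsub; rewrite cardsT => h; apply: leq_trans h _.
rewrite cardsU1; have := leq_imset_card (fun e : edge G => etgt e) [set: edge G].
by rewrite cardsT -/m; case: (_ \notin _) => /=; lia.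
Qed.

Lemma hnL : n < L. Proof. by have := vertices_le; rewrite sizeE; lia. Qed.
Lemma hmL : m < L. Proof. by rewrite sizeE; lia. Qed.

Definition input_ok (mm : nat -> nat) : Prop := forall a, a < L -> mm a = nth 0 w a.

Lemma eval_vertices env mm : input_ok mm -> eval L env mm e_vertices = n.
Proof. by move=> h /=; rewrite h // sizeE. Qed.

Lemma eval_edges env mm : input_ok mm -> eval L env mm e_edges = m.
Proof. by move=> h /=; rewrite h // sizeE. Qed.

Lemma eval_src env mm a : input_ok mm ->
  eval L env mm (e_src a) = gsrc (eval L env mm a).
Proof.
move=> h; rewrite -[LHS]/(if holds L env mm (eLt a e_edges) then _ else _).
rewrite holds_lt eval_edges // /gsrc; case: ifP => // ha.
rewrite -[LHS]/(mm (4 + (eval L env mm a + eval L env mm a))) h //.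
by have := sizeE; lia.
Qed.

Lemma eval_tgt env mm a : input_ok mm ->
  eval L env mm (e_tgt a) = gtgt (eval L env mm a).
Proof.
move=> h; rewrite -[LHS]/(if holds L env mm (eLt a e_edges) then _ else _).
rewrite holds_lt eval_edges // /gtgt; case: ifP => // ha.
rewrite -[LHS]/(mm (5 + (eval L env mm a + eval L env mm a))) h //.
by have := sizeE; lia.
Qed.

Definition relaxed (e : edge G) (mm : nat -> nat) (a : nat) : nat :=
  if a == L + N (etgt e) then maxn (mm a) (mm (L + N (esrc e))).+1 else mm a.

Lemma den_relax_body j i mm : input_ok mm ->
  if i < m then exists2 e, i = E e &
      den L relax_body [:: j; i] mm =1 relaxed e mm
  else den L relax_body [:: j; i] mm = mm.
Proof.
move=> h; rewrite -[den _ _ _ _]/(if holds L [:: j; i] mm (eLt (Var 1) e_edges) then _ else _).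
rewrite holds_lt eval_edges // -[eval _ _ _ (Var 1)]/i; case: ifP => hi; last by rewrite ?hi.
have [e he] : exists e : edge G, i = E e.
  by exists (enum_val (Ordinal hi)); rewrite /ednum enum_valK.
exists e => // a; rewrite ?hi -[LHS]/(if a == L + eval L [:: j; i] mm (e_tgt (Var 1))
  then mm (L + eval L [:: j; i] mm (e_tgt (Var 1)))
    + (mm (L + eval L [:: j; i] mm (e_src (Var 1))) + 1
       - mm (L + eval L [:: j; i] mm (e_tgt (Var 1)))) else mm a).
rewrite eval_src // eval_tgt // /= he gsrcE gtgtE /relaxed.
by case: eqP => // ->; lia.
Qed.

(** * Computing the levels *)

Section Relax.
Variable d : vert G -> nat.
Hypothesis hd : forall e, d (esrc e) < d (etgt e).

(** The cells from [L + n] on include the answer and the table, which have to be empty when the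
    later programs start. *)
Definition levels_ok (mm : nat -> nat) : Prop :=
  [/\ input_ok mm, forall a, L + n <= a -> mm a = 0 & forall v : vert G, mm (L + N v) <= d v].

Definition increasing (mm : nat -> nat) (e : edge G) : Prop :=
  mm (L + N (esrc e)) < mm (L + N (etgt e)).

Lemma addL_N_eq (v u : vert G) : (L + N v == L + N u) = (v == u).
Proof. by rewrite eqn_add2l (inj_eq (@N_inj G)). Qed.

Lemma levels_ok_relaxed e mm mm' :
  mm' =1 relaxed e mm -> levels_ok mm -> levels_ok mm'.
Proof.
move=> hmm [h1 h2 h3]; split=> [a ha|a ha|v]; rewrite hmm /relaxed.
- by rewrite ltn_eqF ?h1 // (leq_trans ha) ?leq_addr.
- by rewrite gtn_eqF ?h2 // (leq_trans _ ha) // ltn_add2l /vnum.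
- rewrite addL_N_eq; case: eqP => [->|] //.
  by rewrite geq_max h3 /= (leq_ltn_trans (h3 _)).
Qed.

(* Once the edges whose heads have rank at most [j] are increasing, the levels of
   these heads never change again. *)
Lemma increasing_relaxed j e e1 mm mm' : mm' =1 relaxed e1 mm ->
  (forall e, d (etgt e) <= j -> increasing mm e) ->
  d (esrc e) <= j -> increasing mm e -> increasing mm' e.
Proof.
move=> hmm hj he hinc; rewrite /increasing !hmm /relaxed !addL_N_eq.
have -> : (if esrc e == etgt e1 then maxn (mm (L + N (esrc e))) (mm (L + N (esrc e1))).+1
    else mm (L + N (esrc e))) = mm (L + N (esrc e)).
  case: eqP => // h; apply/maxn_idPl; rewrite h; apply: hj.
  by rewrite -h.
by case: ifP => // _; rewrite leq_max hinc.
Qed.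

Lemma increasing_hit e mm mm' : mm' =1 relaxed e mm -> increasing mm' e.
Proof.
move=> hmm; rewrite /increasing !hmm /relaxed !addL_N_eq eqxx.
by rewrite (negPf (dag_loopless e hG)) leq_max leqnn orbT.
Qed.

(** An edge whose head has rank at most [j.+1] becomes increasing when its own turn comes. Its tail
    has rank at most [j] and keeps its level, so the edge stays increasing for the rest of the
    round. *)
Lemma relax_round j mm : levels_ok mm ->
  (forall e, d (etgt e) <= j -> increasing mm e) ->
  let mm' := den L (For relax_body) [:: j] mm in
  levels_ok mm' /\ (forall e, d (etgt e) <= j.+1 -> increasing mm' e).
Proof.
move=> hok hj mm'.
pose I mm := levels_ok mm /\ forall e, d (etgt e) <= j -> increasing mm e.
have step i m1 (R : (nat -> nat) -> Prop) : I m1 -> R m1 ->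
    (forall e m2, i = E e -> m2 =1 relaxed e m1 -> R m2) ->
    R (den L relax_body [:: j; i] m1).
  move=> [[h1 _ _] _] h2 h3; have := den_relax_body j i h1.
  case: ifP => _; last by move=> ->.
  by case=> e he hm; exact: h3 he hm.
have hI i m1 : i < L -> I m1 -> I (den L relax_body (rcons [:: j] i) m1).
  move=> _ h; apply: (step i m1 I h h) => e m2 _ hm; case: h => h1 h2.
  split=> [|e1 he1]; first exact: levels_ok_relaxed hm h1.
  apply: (increasing_relaxed hm h2); last exact: h2.
  by apply: leq_trans he1; exact: ltnW.
have hmain e : d (etgt e) <= j.+1 -> increasing mm' e.
  move=> he; apply: (@den_For_hit L relax_body [:: j] mm (E e) I (increasing^~ e)) => //.
  - by apply: ltn_trans hmL; rewrite /ednum.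
  - move=> i m1 _ h h1; apply: (step i m1 (increasing^~ e) h h1) => e1 m2 _ hm.
    by apply: (increasing_relaxed hm h.2) => //; rewrite -ltnS (leq_trans (hd e)).
  - move=> m1 h; have [[h1 _ _] _] := h; have := den_relax_body j (E e) h1.
    rewrite ltn_ord => -[e1 /(@E_inj G) <-]; exact: increasing_hit.
split=> //.
suff [] : I mm' by [].
apply: (@den_For_ind L relax_body [:: j] mm (fun _ => I)) => //.
Qed.

End Relax.

Lemma relax_correct : exists mm, [/\ den L relax_prog [::] (nth 0 w) = mm,
  input_ok mm, forall a, L + n <= a -> mm a = 0,
  forall e : edge G, mm (L + N (esrc e)) < mm (L + N (etgt e)) &
  forall v : vert G, mm (L + N v) < L].
Proof.
have [d [hd hdn]] := bounded_rank.
have h0 a : L <= a -> nth 0 w a = 0.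
  by move=> ha; rewrite nth_default //; move: ha; rewrite /L; lia.
have [[h1 h2 h3] h4] : levels_ok d (den L relax_prog [::] (nth 0 w)) /\
    forall e, d (etgt e) <= L -> increasing (den L relax_prog [::] (nth 0 w)) e.
  apply: (@den_For_ind L (For relax_body) [::] _ (fun j mm => levels_ok d mm /\
    forall e, d (etgt e) <= j -> increasing mm e)).
    by move=> j mm _ [h1 h2]; exact: relax_round.
  split; last by move=> e; rewrite leqNgt (leq_ltn_trans _ (hd e)).
  split=> // [a ha|v]; rewrite h0 //; first exact: leq_trans (leq_addr _ _) ha.
  exact: leq_addr.
eexists; split=> //.
  by move=> e; apply: h4; rewrite ltnW // (ltn_trans (hdn _)) ?hnL.
by move=> v; apply: leq_ltn_trans (h3 v) (ltn_trans (hdn v) hnL).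
Qed.

(** * The table of reachable configurations *)

Section AfterRelax.
Variable M0 : nat -> nat.
Hypothesis hM0 : input_ok M0.
Hypothesis hM0z : forall a, L + n <= a -> M0 a = 0.
Hypothesis hM0i : forall e : edge G, M0 (L + N (esrc e)) < M0 (L + N (etgt e)).
Hypothesis hM0b : forall v : vert G, M0 (L + N v) < L.

Let lv v := if v < n then M0 (L + v) else 0.
Notation s0 := (N (source G)).
Notation t0 := (N (sink G)).
Notation reach := (reachable P n m gsrc gtgt lv s0 t0 L).
Notation accept := (accepted P n m gsrc gtgt lv s0 t0 L).

Lemma accept_model : accept <-> has_model P G.
Proof.
have hN v : N v < n by rewrite /vnum.
apply: accepted_modelP => //.
- exact: gsrcE.
- exact: gtgtE.
- by move=> e; rewrite /lv !hN.
- by move=> v; rewrite /lv hN.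
- by rewrite ltnW ?hnL.
- by rewrite ltnW ?hmL.
- by rewrite sizeE; lia.
Qed.

Definition base (mm : nat -> nat) : Prop := forall a, a < L + L -> mm a = M0 a.

Lemma base_input mm : base mm -> input_ok mm.
Proof. by move=> h a ha; rewrite h ?hM0 // (leq_trans ha) ?leq_addr. Qed.

Lemma eval_level env mm a : base mm ->
  eval L env mm (e_level a) = lv (eval L env mm a).
Proof.
move=> h; have hi := base_input h.
rewrite -[LHS]/(if holds L env mm (eLt a e_vertices) then _ else _).
rewrite holds_lt eval_vertices // /lv; case: ifP => // ha.
rewrite -[LHS]/(mm (L + eval L env mm a)) h // ltn_add2l.
exact: ltn_trans ha hnL.
Qed.

Definition window o (s env : seq nat) : Prop :=
  forall j, j < K -> nth 0 env (o + j) = nth 0 s j.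

Lemma eval_root env mm o s x : window o s env ->
  eval L env mm (e_root o x) = root_of x s.
Proof.
by move=> h; rewrite /= h // /state_size (leq_trans (ltn_ord _)) ?leq_addr.
Qed.

Lemma eval_stage env mm o s (f : edge P) : window o s env ->
  eval L env mm (e_stage o f) = stage f s.
Proof.
move=> h; rewrite /= h // /state_size ltn_add2l.
by rewrite (leq_trans (ltn_ord _)) ?leq_addr.
Qed.

Lemma eval_place env mm o s (f : edge P) : window o s env ->
  eval L env mm (e_place o f) = place f s.
Proof. by move=> h; rewrite /= h // /state_size !ltn_add2l. Qed.

Lemma eval_target env mm o s (f : edge P) : base mm -> window o s env ->
  eval L env mm (e_target o f) = target gtgt f s.
Proof.
move=> hb h; rewrite -[LHS]/(if eval L env mm (e_stage o f) != 0
  then eval L env mm (e_tgt (e_place o f)) else eval L env mm (e_root o (esrc f))).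
rewrite (eval_stage _ _ h) (eval_tgt _ _ (base_input hb)) (eval_place _ _ h).
by rewrite (eval_root _ _ h).
Qed.

Lemma holds_init mm s : base mm -> holds L s mm e_init = init_ok P n s0 t0 s.
Proof.
move=> hb; have h : window 0 s s by [].
have hi := base_input hb.
rewrite /e_init !holdsE !(eval_root _ _ h).
have e2 : eval L s mm (Peek (Cst 2)) = s0 by rewrite /= hi // sizeE.
have e3 : eval L s mm (Peek (Cst 3)) = t0 by rewrite /= hi // sizeE.
rewrite e2 e3 /init_ok; congr [&& _, _, _ & _].
  by apply: eq_forallb => x; rewrite !holdsE (eval_root _ _ h) eval_vertices.
by apply: eq_forallb => f; rewrite !holdsE (eval_stage _ _ h) (eval_place _ _ h).
Qed.

Lemma holds_final mm s : holds L s mm e_final = final_ok P s.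
Proof.
have h : window 0 s s by [].
by rewrite /e_final holdsE; apply: eq_forallb => f; rewrite !holdsE (eval_stage _ _ h).
Qed.

Lemma holds_move env mm o o' s s' (f : edge P) : base mm ->
  window o s env -> window o' s' env ->
  holds L env mm (e_move o o' f) = move_ok m gsrc gtgt lv (nth 0 env 0) s s' f.
Proof.
move=> hb h h'; have hi := base_input hb.
rewrite /e_move /e_early /e_late !holdsE !eval_level //.
rewrite !(eval_target _ hb h) !(eval_stage _ _ h).
rewrite !(eval_stage _ _ h') !(eval_place _ _ h) !(eval_place _ _ h').
by rewrite !eval_src // !(eval_place _ _ h') (eval_root _ _ h) eval_edges.
Qed.

Lemma holds_meet env mm o o' s s' (f g : edge P) : base mm ->
  window o s env -> window o' s' env ->
  holds L env mm (e_meet o o' f g) = meet_ok gtgt lv (nth 0 env 0) s s' f g.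
Proof.
move=> hb h h'.
rewrite /e_meet /e_early /e_late !holdsE !eval_level //.
rewrite !(eval_target _ hb h) !(eval_stage _ _ h).
by rewrite !(eval_stage _ _ h') !(eval_place _ _ h) !(eval_place _ _ h').
Qed.

Lemma holds_step env mm o o' s s' : base mm ->
  window o s env -> window o' s' env ->
  holds L env mm (e_step o o') = step_ok P m gsrc gtgt lv (nth 0 env 0) s s'.
Proof.
move=> hb h h'; rewrite /e_step !holdsE /step_ok; congr [&& _, _ & _].
- by apply: eq_forallb => x; rewrite !holdsE (eval_root _ _ h) (eval_root _ _ h').
- by apply: eq_forallb => f; exact: holds_move.
- apply: eq_forallb => f; rewrite holdsE; apply: eq_forallb => g.
  by rewrite holds_imp holds_bool (holds_meet f g hb h h').
Qed.

Lemma eval_entry env mm a o s : size s = K -> window o s env ->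
  eval L env mm (e_entry a o) = L + L + code L (eval L env mm a) s.
Proof.
move=> hs h; rewrite -[LHS]/(L + L + eval L env mm (e_code a o K)); congr (_ + _).
suff key k : k <= K -> eval L env mm (e_code a o k) = code L (eval L env mm a) (take k s).
  by rewrite key // take_oversize ?hs.
elim: k => [|k IH] hk; first by rewrite take0.
rewrite (take_nth 0) ?hs // /code foldl_rcons -/(code _ _ _) -IH; last exact: ltnW.
by rewrite /= h.
Qed.

Definition entry (mm : nat -> nat) t s : nat := mm (L + L + code L t s).

Definition sound mm : Prop := forall t s, box L K s -> entry mm t s != 0 -> reach t s.

Lemma base_write mm b v : base mm -> base (fun a => if a == L + L + b then v else mm a).
Proof. by move=> h a ha; rewrite ltn_eqF ?h // (leq_trans ha) ?leq_addr. Qed.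

Lemma sound_write mm t s : box L K s -> sound mm -> reach t s ->
  sound (fun a => if a == L + L + code L t s then 1 else mm a).
Proof.
move=> hs hm hr u s' hs'; rewrite /entry.
have [/addnI heq _|_] := eqVneq (L + L + code L u s') (L + L + code L t s).
  by have [-> ->] := code_inj hs' hs heq.
exact: hm.
Qed.

Lemma den_init_body s mm : base mm -> box L K s ->
  den L (When e_init (Write (e_entry (Cst 0) 0) (Cst 1))) s mm =
  if init_ok P n s0 t0 s then fun a => if a == L + L + code L 0 s then 1 else mm a
  else mm.
Proof.
move=> hb /andP[/eqP hs _].
rewrite -[LHS]/(if holds L s mm e_init then
  (fun a => if a == eval L s mm (e_entry (Cst 0) 0) then 1 else mm a) else mm).
by rewrite holds_init // (@eval_entry _ _ _ _ s).
Qed.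

Lemma init_correct : let mm := den L init_prog [::] M0 in
  [/\ base mm, sound mm & forall s, reach 0 s -> entry mm 0 s != 0].
Proof.
pose I mm := base mm /\ sound mm.
have hI s mm : box L K s -> I mm ->
    I (den L (When e_init (Write (e_entry (Cst 0) 0) (Cst 1))) ([::] ++ s) mm).
  move=> hs [h1 h2]; rewrite den_init_body //; case: ifP => // h; split.
    exact: base_write.
  by apply: sound_write => //; split.
have h0 : I M0.
  split=> // t s _; rewrite /entry hM0z //.
  by rewrite -addnA leq_add2l (leq_trans (ltnW hnL)) ?leq_addr.
move=> mm; split; try by case: (den_Fors_inv hI h0).
move=> s [hs hi]; apply: (den_Fors_hit hs hI _ _ h0 (J := fun mm => entry mm 0 s != 0)).
  move=> s' m1 hs' [h1 h2] h3; rewrite den_init_body //; case: ifP => // _.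
  by rewrite /entry; case: ifP.
by move=> m1 [h1 h2]; rewrite den_init_body // hi /entry eqxx.
Qed.

Lemma window_cat o s1 s s2 : size s1 = o -> size s = K -> window o s (s1 ++ s ++ s2).
Proof.
move=> h1 h2 j hj; rewrite nth_cat h1 ltnNge leq_addr /= addKn nth_cat h2 hj.
done.
Qed.

Definition sweep_body : prog :=
  When (eAnd (Peek (e_entry (Var 0) 1)) (e_step 1 K.+1))
    (Write (e_entry (Plus (Var 0) (Cst 1)) K.+1) (Cst 1)).

Lemma den_sweep_body t s s' mm : base mm -> box L K s -> box L K s' ->
  den L sweep_body (([:: t] ++ s) ++ s') mm =
  if (entry mm t s != 0) && step_ok P m gsrc gtgt lv t s s'
  then fun a => if a == L + L + code L t.+1 s' then 1 else mm a
  else mm.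
Proof.
move=> hb /andP[/eqP hs _] /andP[/eqP hs' _].
set env := _ ++ s'.
have h1 : window 1 s env by rewrite /env -catA; exact: window_cat.
have h2 : window K.+1 s' env.
  have -> : env = ([:: t] ++ s) ++ s' ++ [::] by rewrite cats0.
  by apply: window_cat => //=; rewrite hs.
rewrite -[LHS]/(if holds L env mm (eAnd (Peek (e_entry (Var 0) 1)) (e_step 1 K.+1))
  then (fun a => if a == eval L env mm (e_entry (Plus (Var 0) (Cst 1)) K.+1) then 1 else mm a)
  else mm).
rewrite holds_and (holds_step hb h1 h2) (eval_entry _ _ hs' h2) /holds.
rewrite -[eval L env mm (Peek _)]/(mm (eval L env mm (e_entry (Var 0) 1))).
by rewrite (eval_entry _ _ hs h1) /= addn1.
Qed.

Lemma sweep_correct mm : base mm -> sound mm ->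
  (forall s, reach 0 s -> entry mm 0 s != 0) ->
  let mm' := den L sweep_prog [::] mm in
  [/\ base mm', sound mm' & forall s, reach L s -> entry mm' L s != 0].
Proof.
move=> hb hs h0.
pose I t mm := [/\ base mm, sound mm & forall s, reach t s -> entry mm t s != 0].
suff round t m1 : t < L -> I t m1 ->
    I t.+1 (den L (iter K For (iter K For sweep_body)) [:: t] m1).
  exact: (@den_For_ind L _ [::] mm I).
move=> _ h1.
have hI s s' m2 : box L K s -> box L K s' -> I t m2 ->
    I t (den L sweep_body (([:: t] ++ s) ++ s') m2).
  move=> hbs hbs' [i1 i2 i3]; rewrite den_sweep_body //; case: ifP => // /andP[e1 e2].
  split; first exact: base_write.
    apply: sound_write => //; split; first exact: hbs'.
    by exists s => //; exact: i2.
  by move=> s1 /i3; rewrite /entry; case: ifP.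
have hI' s m2 : box L K s -> I t m2 -> I t (den L (iter K For sweep_body) ([:: t] ++ s) m2).
  by move=> hbs; apply: den_Fors_inv => s' m3 hbs'; exact: hI.
have [k1 k2 _] := den_Fors_inv hI' h1.
split=> // s' [hbs' [s hreach hstep]].
have hbs := reachable_bounded hreach.
pose J mm := entry mm t.+1 s' != 0.
have hJ s1 s2 m2 : box L K s1 -> box L K s2 -> I t m2 -> J m2 ->
    J (den L sweep_body (([:: t] ++ s1) ++ s2) m2).
  move=> hb1 hb2 [i1 _ _] j2; rewrite den_sweep_body //; case: ifP => // _.
  by rewrite /J /entry; case: ifP.
(* The entry of [s'] is written when the outer loops hold its predecessor [s] and the inner ones
   [s']. *)
apply: (den_Fors_hit hbs hI' _ _ h1 (J := J)).
  move=> s1 m2 hb1 i1 j1.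
  suff [] : I t (den L (iter K For sweep_body) ([:: t] ++ s1) m2) /\
    J (den L (iter K For sweep_body) ([:: t] ++ s1) m2) by [].
  apply: (den_Fors_inv (I := fun m => I t m /\ J m)) => // s2 m3 hb2 [i2 j2].
  by split; [exact: hI|exact: hJ].
move=> m2 i2; apply: (den_Fors_hit hbs' (fun s2 m3 hb2 => hI s s2 m3 hbs hb2) _ _ i2 (J := J)).
  by move=> s2 m3 hb2; exact: hJ.
move=> m3 [i1 i3 i4]; rewrite den_sweep_body // hstep i4 //.
by rewrite /J /entry /= eqxx.
Qed.

Lemma answer_correct mm : base mm -> sound mm ->
  (forall s, reach L s -> entry mm L s != 0) ->
  let mm' := den L answer_prog [::] mm in
  (eval L [::] mm' (Peek e_answer) != 0) <-> accept.
Proof.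
move=> hb hs hc mm'.
(* The answer cell lies below [L + L], so [base] is lost once it is written. The invariant keeps
   what the loop still reads, namely the table and the number of vertices. *)
pose I m1 := [/\ forall a, L + L <= a -> m1 a = mm a, m1 0 = n & m1 (L + n) != 0 -> accept].
have body s m1 : box L K s -> I m1 ->
    den L (When (eAnd (Peek (e_entry Len 0)) e_final) (Write e_answer (Cst 1))) ([::] ++ s) m1
    = if (entry mm L s != 0) && final_ok P s
      then fun a => if a == L + n then 1 else m1 a else m1.
  move=> /andP[/eqP hbs _] [i1 i2 _] /=.
  rewrite -[LHS]/(if holds L s m1 (eAnd (Peek (e_entry Len 0)) e_final)
    then (fun a => if a == L + m1 0 then 1 else m1 a) else m1).
  rewrite holds_and holds_final i2 /holds.
  rewrite -[eval L s m1 (Peek _)]/(m1 (eval L s m1 (e_entry Len 0))).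
  by rewrite (@eval_entry _ _ _ _ s) //= i1 ?leq_addr.
have hI s m1 : box L K s -> I m1 ->
    I (den L (When (eAnd (Peek (e_entry Len 0)) e_final)
      (Write e_answer (Cst 1))) ([::] ++ s) m1).
  move=> hbs hi; rewrite body //; case: ifP => // /andP[h1 h2].
  have [i1 i2 i3] := hi; split.
  - move=> a ha; rewrite gtn_eqF ?i1 //; apply: leq_trans ha.
    by rewrite ltn_add2l hnL.
  - by rewrite ltn_eqF // sizeE.
  - by move=> _; exists s => //; exact: hs.
have h0 : I mm.
  split=> //; first by rewrite hb ?hM0 // sizeE.
  by rewrite hb ?hM0z // ltn_add2l hnL.
have [i1 i2 i3] : I mm' := den_Fors_inv hI h0.
have -> : eval L [::] mm' (Peek e_answer) = mm' (L + n) by rewrite -i2.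
split=> // -[s hreach hfin].
have hbs := reachable_bounded hreach.
apply: (den_Fors_hit hbs hI _ _ h0 (J := fun m1 => m1 (L + n) != 0)).
  by move=> s1 m1 hb1 i j; rewrite body //; case: ifP => // _; case: ifP.
by move=> m1 i; rewrite body // hc // hfin /= eqxx.
Qed.

End AfterRelax.

Lemma main_correct :
  (eval L [::] (den L main_prog [::] (nth 0 w)) (Peek e_answer) != 0) <-> has_model P G.
Proof.
have [M0 [hM h1 h2 h3 h4]] := relax_correct.
rewrite /main_prog -[den L (Then _ _) _ _]/(den L answer_prog [::] (den L sweep_prog [::]
  (den L init_prog [::] (den L relax_prog [::] (nth 0 w))))) hM.
have [b1 b2 b3] := init_correct h1 h2.
have [c1 c2 c3] := sweep_correct h1 b1 b2 b3.
apply: iff_trans (accept_model h3 h4).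
exact: answer_correct.
Qed.

End Run.
End Program.

Unset Implicit Arguments.

Theorem theorem39 (G' : mgraph) (hG' : tdag G') :
  ptime_decidable tdag (fun G : mgraph => d_embedded G' G) /\
  ptime_decidable tdag (fun G : mgraph => d_minor G' G).
Proof.
have hP := tdag_dag hG'.
have [hst|hst] := eqVneq (source G') (sink G').
  split.
    (* Cell 0 is copied onto itself: a program without effect, the test being made by the final
       expression. *)
    apply: (@ptime_decidable_prog _ _ 0 (Write (Cst 0) e_vertices)
      (eEq e_vertices (Cst 1))) => G /tdag_dag hG L.
    rewrite -/(holds _ _ _ _) holds_eq.
    apply: iff_trans (iff_sym (d_embedded_trivial hP hG hst)).
    by split=> /eqP.
  apply: (@ptime_decidable_prog _ _ 0 (Write (Cst 0) e_vertices) (Cst 1)) => G /tdag_dag hG L.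
  by split=> // _; exact: d_minor_trivial.
split; apply: (@ptime_decidable_prog _ _ 5 (main_prog G') (Peek e_answer)) => G /tdag_dag hG L.
  apply: iff_trans (main_correct hP hst hG) _.
  by apply: iff_sym; exact: d_embedded_modelE.
apply: iff_trans (main_correct hP hst hG) _.
by apply: iff_sym; exact: d_minor_modelE.
Qed.
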